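(* Let $\bm u(\bm x,t)$ and $\bm\alpha(\bm x,t)$ be sufficiently smooth vector fields on $\mathbb R^d$, let $W_t$ be a scalar standard Brownian motion, and let $\bm A=\nabla\bm\alpha$. Let $J=\det\bm F$ be the local volume ratio of the stochastic map $\mathrm d\bm x_t=\bm u(\bm x_t,t)\,\mathrm dt+\bm\alpha(\bm x_t,t)\,\mathrm dW_t$. Then $$\mathrm d\log J=(\nabla\cdot\bm\alpha)\,\mathrm dW_t+\left[\nabla\cdot\bm u-\tfrac12\operatorname{tr}(\bm A^2)\right]\mathrm dt .$$ Hence pathwise isochoricity (that is, $\mathrm d\log J=0$) is equivalent to $$\nabla\cdot\bm\alpha=0,\qquad \nabla\cdot\bm u=\tfrac12\operatorname{tr}(\bm A^2).$$ If moreover $\bm s=\tfrac12\nabla\cdot(\bm\alpha\otimes\bm\alpha)$ and $\bm v=\bm u-\bm s$, then these conditions give $\nabla\cdot\bm v=0$.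
   Context: The convention is $(\nabla\bm\alpha)_{ij}=\partial_j\alpha_i$, and $(\nabla\cdot(\bm\alpha\otimes\bm\alpha))_i=\partial_j(\alpha_i\alpha_j)$. The local relative deformation is $\bm F=\bm I+\bm A\,\mathrm dW_t+\bm L\,\mathrm dt$ with $\bm L=\nabla\bm u$, considered while $\det\bm F>0$; differentials are Itô differentials, with $\mathrm dW_t\,\mathrm dW_t=\mathrm dt$ and other products zero. The increment $\mathrm d\log J$ equals the common trace of the local material and spatial Hencky increments $\tfrac12\log(\bm F^{\mathsf T}\bm F)$ and $\tfrac12\log(\bm F\bm F^{\mathsf T})$, taken through order $\mathrm dt$. *)

(* Defs.v *)
From HB Require Import structures.
From mathcomp Require Import all_boot all_order all_algebra.
From mathcomp Require Import all_classical all_reals all_analysis.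

Set Implicit Arguments.
Unset Strict Implicit.
Unset Printing Implicit Defensive.

Import Order.TTheory GRing.Theory Num.Theory.
Import numFieldNormedType.Exports.

Local Open Scope classical_set_scope.
Local Open Scope ring_scope.

Section VectorCalculus.
Context {R : realType} {d : nat}.

Definition partial (f : 'cV[R]_d -> R) (j : 'I_d) (x : 'cV[R]_d) : R :=
  'D_(delta_mx j ord0) f x.

Fixpoint Ck (k : nat) (f : 'cV[R]_d -> R) : Prop :=
  match k with
  | 0 => continuous f
  | k'.+1 => continuous f /\
      forall j : 'I_d, (forall x, derivable f x (delta_mx j ord0)) /\
                       Ck k' (partial f j)
  end.

Definition vCk (k : nat) (f : 'cV[R]_d -> 'cV[R]_d) : Prop :=
  forall i : 'I_d, Ck k (fun x => f x i ord0).

(* Row i, column j is the j-th partial derivative of the i-th component; the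
   library's [jacobian] acts on row vectors and is the transpose of this. *)
Definition grad (f : 'cV[R]_d -> 'cV[R]_d) (x : 'cV[R]_d) : 'M[R]_d :=
  \matrix_(i, j) partial (fun y => f y i ord0) j x.

Definition div (f : 'cV[R]_d -> 'cV[R]_d) (x : 'cV[R]_d) : R :=
  \sum_(i < d) partial (fun y => f y i ord0) i x.

(* The derivative is contracted with the second index. *)
Definition tdiv (T : 'cV[R]_d -> 'M[R]_d) (x : 'cV[R]_d) : 'cV[R]_d :=
  \col_i \sum_(j < d) partial (fun y => T y i j) j x.

Definition outer (a b : 'cV[R]_d) : 'M[R]_d := a *m b^T.

End VectorCalculus.

(* Mercator series, in the normed space of matrices. When the series diverges
   the value is unspecified; it converges for M close to the identity, which
   is the only regime that matters for infinitesimal increments. *)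
Definition mxlog {R : realType} {n : nat} (M : 'M[R]_n) : 'M[R]_n :=
  limn (series (fun k : nat =>
    ((-1) ^+ k / k.+1%:R : R) *: ((M - 1%:M) ^+ k.+1 : 'M[R]_n))).

Section Ito.
Context {R : realType} {dsp : measure_display} {Omega : measurableType dsp}.
Variable P : probability Omega R.

(* The time index is a real number; only nonnegative times are constrained.
   [normal_prob] takes the standard deviation, not the variance. *)
Definition standard_brownian (W : R -> {RV P >-> R}) : Prop :=
  [/\ {ae P, forall w, W 0 w = 0},
      {ae P, forall w, {within `[0, +oo[, continuous (fun t => W t w)}},
      (forall s t : R, 0 <= s -> s < t -> forall B : set R, measurable B ->
         P [set w | B (W t w - W s w)] = normal_prob 0 (Num.sqrt (t - s)) B) &
      (forall (n : nat) (t : nat -> R) (B : nat -> set R),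
         0 <= t 0 -> (forall i, t i <= t i.+1) ->
         (forall i, measurable (B i)) ->
         P [set w | forall i, (i < n)%N -> B i (W (t i.+1) w - W (t i) w)] =
         (\prod_(i < n) P [set w | B i (W (t i.+1) w - W (t i) w)%R])%E)].

(* Increments over a time step h are families Z : R -> Omega -> R indexed by
   h > 0.  Z vanishes through order dt when its mean and its second moment are
   both o(h): such one-step errors sum to 0 in L^2 over a partition whose mesh
   tends to 0, which is why Ito calculus discards them.  Z need only make sense
   on D h (where, for example, a logarithm is defined), and the moments may be
   localized to events G h included in D h whose complements have probability
   o(h); the choice of such G does not matter.

   For the increment dW = W (t + h) - W t of a standard Brownian motion this
   yields the Ito table: the family dW ^+ 2 - h has mean 0 and second moment
   2 h ^+ 2, the family dW * h has mean 0 and second moment h ^+ 3, and h * h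
   is deterministic of order 2, so the three vanish through order dt.  On the
   other hand a * dW + b * h vanishes through order dt only if a = b = 0. *)
Definition ito_negligible (D : R -> set Omega) (Z : R -> Omega -> R) : Prop :=
  exists G : R -> set Omega,
    [/\ (\forall h \near 0^'+,
           [/\ measurable (G h), G h `<=` D h & measurable_fun (G h) (Z h)]),
        ((h^-1)%:E * P (~` G h))%E @[h --> 0^'+] --> 0%E,
        ((h^-1)%:E * \int[P]_(w in G h) (Z h w)%:E)%E @[h --> 0^'+] --> 0%E &
        ((h^-1)%:E * \int[P]_(w in G h) ((Z h w) ^+ 2)%:E)%E @[h --> 0^'+]
           --> 0%E].

Definition ito_eq (D : R -> set Omega) (X Y : R -> Omega -> R) : Prop :=
  ito_negligible D (fun h w => X h w - Y h w).

Definition dB (W : R -> {RV P >-> R}) (t h : R) (w : Omega) : R :=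
  W (t + h) w - W t w.

Definition ito_form (W : R -> {RV P >-> R}) (t a b h : R) (w : Omega) : R :=
  a * dB W t h w + b * h.

Section Deformation.
Variables (d : nat) (u alpha : 'cV[R]_d -> R -> 'cV[R]_d).
Variables (W : R -> {RV P >-> R}) (x : 'cV[R]_d) (t : R).

(* Gradient of the one-step map
   y |-> y + alpha y t * (W (t + h) - W t) + u y t * h. *)
Definition deformation (h : R) (w : Omega) : 'M[R]_d :=
  1%:M + dB W t h w *: grad (alpha ^~ t) x + h *: grad (u ^~ t) x.

Definition volume_ratio (h : R) (w : Omega) : R := \det (deformation h w).

Definition orientation_preserved (h : R) : set Omega :=
  [set w | 0 < volume_ratio h w].

Definition dlogJ (h : R) (w : Omega) : R := ln (volume_ratio h w).

Definition hencky_material (h : R) (w : Omega) : 'M[R]_d :=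
  2^-1 *: mxlog ((deformation h w)^T *m deformation h w).

Definition hencky_spatial (h : R) (w : Omega) : 'M[R]_d :=
  2^-1 *: mxlog (deformation h w *m (deformation h w)^T).

End Deformation.
End Ito.

(* Main.v *)
(* On the event |dW| <= delta, the gradient F = 1 + A dW + L h is close to the
   identity, and a deterministic expansion gives
     log det F = tr X - tr(X^2)/2 + O(|X|^3),   X = A dW + L h,
   with the same expansion for tr log(F^T F) / 2 through the Mercator series.
   Substituting X leaves the stated form, the term -tr(A^2)/2 (dW^2 - h), whose
   mean vanishes, and a remainder dominated by (|dW| + h)(dW^2 + h), whose mean
   is O(h^(3/2)) because E dW^2 = h and E dW^4 = 3 h^2.  Conversely, if
   a dW + b h is negligible, its second moment a^2 h + o(h) forces a = 0, and
   then its mean b h forces b = 0.  For the last claim, div alpha = 0 turns s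
   into (grad alpha) alpha / 2, and the second-order terms of div s form the
   derivative of div alpha along alpha, by symmetry of second derivatives. *)

Require Import Defs.
From HB Require Import structures.
From mathcomp Require Import all_boot all_order all_algebra.
From mathcomp Require Import all_classical all_reals all_analysis.
From mathcomp Require Import measurable_realfun ring lra.

Set Implicit Arguments.
Unset Strict Implicit.
Unset Printing Implicit Defensive.

Import Order.TTheory GRing.Theory Num.Theory.
Import numFieldNormedType.Exports.

Local Open Scope classical_set_scope.
Local Open Scope ring_scope.

(** * Second-order expansions of log det and of the Mercator series *)

Section LogDet.
Context {R : realType}.

(** The obstacle is localization. A negligible family comes with its own events, while [dW ^+ 2 - h]
    has mean zero over the whole space and not over such an event. So integrands are extended by
    zero off their event, the compensator is kept on all of [Omega], and its contribution on the
    complement is paid for with the fourth moment. A single majorant [dom] serves every estimate: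
    weights in [sqrt h] trade odd powers of [|dW|] for even ones, so that only even moments are ever
    computed. The radius delta is a constant independent of [h]. The expansion of log det avoids
    eigenvalues: it is an induction on the size through Schur complements. *)

Lemma ln1D_taylor2 (x : R) : `|x| <= 2^-1 ->
  `|ln (1 + x) - x + 2^-1 * x ^+ 2| <= 2 * `|x| ^+ 3.
Proof.
move=> xb; pose f y : R := ln (1 + y) - y + 2^-1 * y ^+ 2.
pose df (y : R) : R := (1 + y)^-1 - 1 + y.
have dfE (y : R) : - 2^-1 <= y -> is_derive y 1 f (df y).
  move=> yb.
  have y0 : 0 < 1 + y by lra.
  have H1 : is_derive y 1 (fun z => ln (1 + z)) (1 + y)^-1.
    have -> : (fun z : R => ln (1 + z)) = @ln R \o (fun z => 1 + z) by [].
    have L := is_derive1_ln y0.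
    apply: is_derive_eq.
    by rewrite add0r !mulr1.
  apply: is_derive_eq.
  rewrite /df /GRing.scale/=.
  field.
  by rewrite gt_eqF.
have f0 : f 0 = 0 by rewrite /f addr0 ln1 subr0 expr0n mulr0 addr0.
(* The derivative is [y ^+ 2 / (1 + y)], and [1 + y >= 1/2] gives the factor 2; the mean value
   theorem between 0 and [x] then supplies the third power of [|x|]. *)
have dfb y : `|y| <= `|x| -> `|df y| <= 2 * `|x| ^+ 2.
  move=> yx; have yb : - 2^-1 <= y <= 2^-1 by rewrite -ler_norml (le_trans yx).
  have y0 : 0 < 1 + y by lra.
  have -> : df y = y ^+ 2 / (1 + y) by rewrite /df; field; rewrite gt_eqF.
  rewrite normrM normfV (gtr0_norm y0) normrX mulrC ler_pM ?invr_ge0 ?exprn_ge0 ?(ltW y0)//.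
    by rewrite -[leRHS]invrK lef_pV2 ?posrE ?invr_gt0//; lra.
  by rewrite lerXn2r ?nnegrE.
have key c a b : `|c| <= `|x| -> `|b - a| = `|x| ->
    f b - f a = df c * (b - a) -> `|f b - f a| <= 2 * `|x| ^+ 3.
  move=> cx bax ->; rewrite normrM bax (exprSr _ 2) mulrA.
  by rewrite ler_wpM2r ?dfb.
have xb' : - 2^-1 <= x <= 2^-1 by rewrite -ler_norml.
have cf a b : - 2^-1 <= a -> {within `[a, b], continuous f}.
  move=> ab; apply: derivable_within_continuous => y.
  rewrite in_itv/= => /andP[ay _]; have [//] := dfE y (le_trans ab ay).
have [x0|x0] := leP 0 x.
  have [|||c] := @MVT_segment R f df 0 x.
  - by [].
  - by move=> y; rewrite in_itv/= => /andP[y0 yx]; apply: dfE; lra.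
  - by apply: cf; lra.
  rewrite in_itv/= => /andP[c0 cx] E.
  have := key _ _ _ _ _ E; rewrite f0 !subr0; apply => //.
  by rewrite !ger0_norm.
have [|||c] := @MVT_segment R f df x 0.
- exact: ltW.
- by move=> y; rewrite in_itv/= => /andP[y0 yx]; apply: dfE; lra.
- by apply: cf; lra.
rewrite in_itv/= => /andP[c0 cx] E.
have := key _ _ _ _ _ E; rewrite f0 !sub0r !normrN; apply => //.
by rewrite !ler0_norm ?lerN2// ltW.
Qed.

(** Elimination of the pivot [1 + a]. The Schur complement is again a perturbation of the identity,
    which allows an induction on the size. *)
Lemma det_1D_schur n (a : R) (b : 'rV[R]_n) (c : 'cV[R]_n) (D : 'M[R]_n) :
  1 + a != 0 ->
  \det (1%:M + block_mx (a%:M : 'M[R]_1) b c D) =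
  (1 + a) * \det (1%:M + (D - (1 + a)^-1 *: (c *m b))).
Proof.
move=> a0; have -> : 1%:M + block_mx (a%:M : 'M[R]_1) b c D =
    block_mx (1%:M : 'M[R]_1) 0 ((1 + a)^-1 *: c) 1%:M *m
    block_mx ((1 + a)%:M : 'M[R]_1) b 0 (1%:M + (D - (1 + a)^-1 *: (c *m b))).
  rewrite mulmx_block !mul1mx !mul0mx !addr0 scalar_mx_block add_block_mx.
  rewrite add0r mul_mx_scalar scalerA divff// scale1r -scalemxAl !add0r.
  by rewrite addrCA subrKC raddfD.
by rewrite det_mulmx det_lblock det_ublock !det1 !mul1r det_scalar1.
Qed.

Lemma mxtrace_sqr_block n (a : R) (b : 'rV[R]_n) (c : 'cV[R]_n) (D : 'M[R]_n) :
  \tr (block_mx (a%:M : 'M[R]_1) b c D *m block_mx (a%:M : 'M[R]_1) b c D) =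
  a ^+ 2 + 2 * \tr (c *m b) + \tr (D *m D).
Proof.
rewrite mulmx_block mxtrace_block !raddfD/= -scalar_mxM mxtrace_scalar mulr1n.
by rewrite (mxtrace_mulC b c); ring.
Qed.

Lemma ler_norm_mulmx m n p (A : 'M[R]_(m, n)) (B : 'M[R]_(n, p)) (r s : R) i j :
  (forall i j, `|A i j| <= r) -> (forall i j, `|B i j| <= s) ->
  `|(A *m B) i j| <= n%:R * (r * s).
Proof.
move=> Ar Bs; rewrite mxE (le_trans (ler_norm_sum _ _ _))//.
rewrite (@le_trans _ _ (\sum_(k < n) r * s))//.
  by apply: ler_sum => k _; rewrite normrM ler_pM.
by rewrite sumr_const card_ord mulr_natl.
Qed.

Lemma ler_norm_mxtrace n (A : 'M[R]_n) (r : R) :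
  (forall i j, `|A i j| <= r) -> `|\tr A| <= n%:R * r.
Proof.
move=> Ar; rewrite (le_trans (ler_norm_sum _ _ _))//.
rewrite (@le_trans _ _ (\sum_(k < n) r))//; first exact: ler_sum.
by rewrite sumr_const card_ord mulr_natl.
Qed.

(** The Schur complement splits the logarithm into [ln (1 + a)] and the smaller problem at
    [Y = D - (1 + a)^-1 c b]. The trace of [Y] differs from that of [D] by about [s = tr (c b)],
    which is exactly the cross term of [tr (X^2) / 2]; the rest is cubic. *)
Lemma ln_det_1D_taylor2 n : exists2 K : R, 0 <= K &
  exists2 dl : R, 0 < dl & forall (X : 'M[R]_n) r, r <= dl ->
    (forall i j, `|X i j| <= r) -> 0 <= r ->
    0 < \det (1%:M + X) /\
    `|ln (\det (1%:M + X)) - \tr X + 2^-1 * \tr (X *m X)| <= K * r ^+ 3.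
Proof.
elim: n => [|n [K K0 [dl dl0 IH]]].
  exists 0 => //; exists 1 => // X r _ _ _.
  by rewrite det_mx00 ln1 ltr01 /mxtrace !big_ord0 mul0r subrr mulr0 addr0 normr0.
pose N : R := n%:R; have N0 : 0 <= N by exact: ler0n.
(* In order: the scalar expansion at [a], the induction hypothesis at [2 * r], the replacement of
   [(1 + a)^-1 * s] by [s], and half of the bound [6 N^2] on [tr (D^2) - tr (Y^2)]. *)
exists (2 + 8 * K + 2 * N + 3 * N ^+ 2).
  by rewrite !addr_ge0 ?mulr_ge0 ?exprn_ge0.
(* The entries of [Y] are at most [2 * r], hence [dl / 2]; the other bound keeps the pivot away from
   0. *)
exists (Num.min (dl / 2) 2^-1).
  by rewrite lt_min invr_gt0 ltr0n andbT divr_gt0.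
rewrite -[n.+1]/(1 + n)%N => X r; rewrite le_min => /andP[rdl r2] Xr r0.
set a := X ord0 ord0; set b := ursubmx X; set c := dlsubmx X; set D := drsubmx X.
have XE : X = block_mx (a%:M : 'M[R]_1) b c D.
  rewrite -[LHS]submxK; congr block_mx.
  apply/matrixP => i j; rewrite !ord1 !mxE eqxx mulr1n /a.
  by congr (X _ _); exact/val_inj.
have aa : `|a| <= 2^-1 by exact: le_trans (Xr _ _) r2.
have ar : `|a| <= r by exact: Xr.
have br i j : `|b i j| <= r by rewrite !mxE.
have cr i j : `|c i j| <= r by rewrite !mxE.
have Dr i j : `|D i j| <= r by rewrite !mxE.
have a1 : 2^-1 <= 1 + a by move: aa; rewrite ler_norml => /andP[]; lra.
have a0 : 0 < 1 + a by rewrite (lt_le_trans _ a1)// invr_gt0.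
have ia : `|(1 + a)^-1| <= 2.
  by rewrite gtr0_norm ?invr_gt0// -[leRHS]invrK lef_pV2 ?posrE ?invr_gt0.
pose E := (1 + a)^-1 *: (c *m b); pose Y := D - E.
have cbr i j : `|(c *m b) i j| <= r * r.
  by rewrite -[leRHS]mul1r; exact: ler_norm_mulmx.
have Er i j : `|E i j| <= 2 * (r * r) by rewrite mxE normrM ler_pM.
have Yr i j : `|Y i j| <= 2 * r.
  rewrite !mxE [`|_|](_ : _ = `|D i j - E i j|); last by rewrite !mxE.
  rewrite (le_trans (ler_normB _ _))// (le_trans (lerD (Dr i j) (Er i j)))//.
  by nra.
have [||dY lY] := IH Y (2 * r) _ Yr; first by lra.
  by rewrite mulr_ge0.
rewrite XE det_1D_schur ?gt_eqF// -/E -/Y; split; first exact: mulr_gt0.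
rewrite lnM ?posrE// mxtrace_sqr_block mxtrace_block mxtrace_scalar mulr1n.
set s := \tr (c *m b).
have sr : `|s| <= N * (r * r) by exact: ler_norm_mxtrace.
have trYE : \tr Y = \tr D - (1 + a)^-1 * s by rewrite /Y raddfB/= /E mxtraceZ.
have t3 : `|s - (1 + a)^-1 * s| <= 2 * N * r ^+ 3.
  have -> : s - (1 + a)^-1 * s = (1 + a)^-1 * (a * s) by field; rewrite gt_eqF.
  rewrite !normrM (_ : 2 * N * r ^+ 3 = 2 * (r * (N * (r * r)))); last by ring.
  by rewrite !ler_pM// mulr_ge0.
have t4 : `|\tr (D *m D) - \tr (Y *m Y)| <= 6 * N ^+ 2 * r ^+ 3.
  have -> : \tr (D *m D) - \tr (Y *m Y) = \tr (D *m E) + \tr (E *m Y).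
    have -> : D = Y + E by rewrite /Y subrK.
    by rewrite !mulmxDl !mulmxDr !raddfD/=; ring.
  rewrite (le_trans (ler_normD _ _))//.
  have -> : 6 * N ^+ 2 * r ^+ 3 =
     N * (N * (r * (2 * (r * r)))) + N * (N * ((2 * (r * r)) * (2 * r))) by ring.
  by apply: lerD; apply: ler_norm_mxtrace => i j; exact: ler_norm_mulmx.
have t1 := ln1D_taylor2 aa.
have t1' : 2 * `|a| ^+ 3 <= 2 * r ^+ 3 by rewrite ler_pM2l// lerXn2r ?nnegrE.
set T2 := ln _ - \tr Y + _ in lY.
set T1 := ln _ - a + _ in t1.
rewrite [X in `|X|](_ : _ = T1 + T2 + (s - (1 + a)^-1 * s) +
    2^-1 * (\tr (D *m D) - \tr (Y *m Y))); last first.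
  by rewrite /T1 /T2 trYE; field; rewrite gt_eqF.
rewrite (le_trans (ler_normD _ _))// (le_trans (lerD (ler_normD _ _) (lexx _)))//.
rewrite (le_trans (lerD (lerD (ler_normD _ _) (lexx _)) (lexx _)))//.
rewrite (normrM 2^-1) ger0_norm//.
rewrite [leRHS](_ : _ = 2 * r ^+ 3 + K * (2 * r) ^+ 3 + 2 * N * r ^+ 3 +
   2^-1 * (6 * N ^+ 2 * r ^+ 3)); last by field.
rewrite !lerD ?ler_wpM2l//; exact: le_trans t1 _.
Qed.

Lemma expr_mx_bound n (X : 'M[R]_n) (r : R) k i j : (forall i j, `|X i j| <= r) ->
  `|(X ^+ k) i j| <= (n%:R * r) ^+ k.
Proof.
move=> Xr; elim: k i j => [|k IH] i j.
  by rewrite !expr0 mxE; case: eqP; rewrite ?normr1 ?normr0.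
by rewrite exprS [leRHS]exprS -[leRHS]mulrA; exact: ler_norm_mulmx.
Qed.

Lemma cvg_mx_entries n (u : nat -> 'M[R]_n) (M : 'M[R]_n) :
  (forall i j, u k i j @[k --> \oo] --> M i j) -> u @ \oo --> M.
Proof.
move=> uM; apply/cvgrPdist_lt => e e0.
have : \forall k \near \oo, forall i j, `|M i j - u k i j| < e.
  apply: filter_forall => i; apply: filter_forall => j.
  by move/cvgrPdist_lt : (uM i j); exact.
apply: filterS => k ue; rewrite [ltLHS]/Num.Def.normr/= mx_normrE.
by apply/bigmax_ltP; split => // -[i j] _ /=; rewrite !mxE.
Qed.

Lemma mxtrace_cvg n (u : nat -> 'M[R]_n) (M : 'M[R]_n) :
  u @ \oo --> M -> \tr (u k) @[k --> \oo] --> \tr M.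
Proof.
move=> uM; rewrite /mxtrace; apply: cvg_big => // [|i _].
  by apply: add_continuous.
apply: (@cvg_comp _ _ _ u (fun A : 'M[R]_n => A i i) _ (nbhs M)) => //.
exact: coord_continuous.
Qed.

(** Entries of [X^k] are at most [(n r)^k], so a geometric series dominates once [n r <= 1/2], and
    the traces from the third term on add up to at most [2 n (n r)^3]. Convergence is part of the
    conclusion because it later makes the trace of [mxlog] measurable. *)
Lemma tr_mxlog_1D_taylor2 n : exists2 K : R, 0 <= K &
  exists2 dl : R, 0 < dl & forall (X : 'M[R]_n) r, r <= dl ->
    (forall i j, `|X i j| <= r) -> 0 <= r ->
    (\sum_(0 <= k < m) ((-1) ^+ k / k.+1%:R * \tr (X ^+ k.+1))
       @[m --> \oo] --> \tr (mxlog (1%:M + X))) /\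
    `|\tr (mxlog (1%:M + X)) - \tr X + 2^-1 * \tr (X *m X)| <= K * r ^+ 3.
Proof.
pose N : R := n%:R; have N0 : 0 <= N by exact: ler0n.
exists (2 * N ^+ 4); first by rewrite mulr_ge0 ?exprn_ge0.
have N1 : 0 < N + 1 by rewrite ltr_wpDl.
(* [N + 1] instead of [N] keeps the radius positive for the empty matrix. *)
exists (2 * (N + 1))^-1; first by rewrite invr_gt0 mulr_gt0.
move=> X r rdl Xr r0; pose q := N * r.
have q0 : 0 <= q by rewrite mulr_ge0.
have q2 : q <= 2^-1.
  have : (N + 1) * r <= (N + 1) * (2 * (N + 1))^-1 by rewrite ler_wpM2l// ltW.
  rewrite invfM mulrCA divff ?gt_eqF// mulr1; apply: le_trans.
  by rewrite ler_wpM2r// lerDl.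
pose c k : R := (-1) ^+ k / k.+1%:R.
have cle k : `|c k| <= 1.
  rewrite normrM normrX normrN1 expr1n mul1r ger0_norm ?invr_ge0//.
  by rewrite invf_le1 ?ltr0n// ler1n.
pose a k : 'M[R]_n := c k *: (X ^+ k.+1).
have ab k i j : `|a k i j| <= q ^+ k.+1.
  rewrite mxE normrM -[leRHS]mul1r; apply: ler_pM => //.
  exact: expr_mx_bound.
have acvg : cvgn (series a).
  apply/cvg_ex; exists (\matrix_(i, j) limn (series (fun k => a k i j))).
  apply: cvg_mx_entries => i j; rewrite mxE.
  have -> : (fun m => series a m i j) = series (fun k => a k i j).
    by apply/funext => m; rewrite /series/= summxE.
  apply: normed_cvg; apply: (@series_le_cvg _ _ (geometric q q)) => //.
  - by move=> k /=.
  - by move=> k; rewrite /geometric/= mulr_ge0 ?exprn_ge0.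
  - by move=> k; rewrite /= -exprS.
  - by apply: is_cvg_geometric_series; rewrite ger0_norm//; lra.
have logE : mxlog (1%:M + X) = limn (series a).
  by rewrite /mxlog; under eq_fun do rewrite addrAC subrr add0r.
have trE m : \tr (series a m) = \sum_(0 <= k < m) (c k * \tr (X ^+ k.+1)).
  by rewrite /series/= raddf_sum/=; apply: eq_bigr => k _; rewrite mxtraceZ.
have cvgT : \sum_(0 <= k < m) (c k * \tr (X ^+ k.+1)) @[m --> \oo]
    --> \tr (mxlog (1%:M + X)).
  under eq_fun do rewrite -trE; rewrite logE; exact: mxtrace_cvg.
split; first exact: cvgT.
set T := \tr X - 2^-1 * \tr (X *m X).
(* The first two terms are exactly [T]. The subtracted power makes the induction close: [q <= 1/2]
   gives [q^(m+3) <= 2 (q^(m+3) - q^(m+4))]. *)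
have bnd m : `|\sum_(0 <= k < m.+2) (c k * \tr (X ^+ k.+1)) - T| <=
    2 * N * (q ^+ 3 - q ^+ m.+3).
  elim: m => [|m IH].
    rewrite !big_nat_recr//= big_geq// /c !expr0 !expr1 expr2 /T.
    rewrite [X in `|X|](_ : _ = 0) ?normr0 ?subrr ?mulr0//; last by field.
  rewrite big_nat_recr//= addrAC (le_trans (ler_normD _ _))//.
  have cm : `|c m.+2 * \tr (X ^+ m.+3)| <= N * q ^+ m.+3.
    by rewrite -mxtraceZ; apply: ler_norm_mxtrace => i j; exact: ab.
  rewrite (le_trans (lerD IH cm))// (exprS _ m.+3).
  have : 0 <= q ^+ m.+3 by rewrite exprn_ge0.
  move: (q ^+ m.+3) (q ^+ 3) => z w z0.
  have : 0 <= N * z * (1 - 2 * q) by rewrite !mulr_ge0//; lra.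
  by lra.
have : `|\tr (mxlog (1%:M + X)) - T| <= 2 * N * q ^+ 3.
  have /cvg_norm : \sum_(0 <= k < m) (c k * \tr (X ^+ k.+1)) - T @[m --> \oo]
      --> \tr (mxlog (1%:M + X)) - T.
    by apply: cvgB => //; exact: cvg_cst.
  move=> /cvgr_to_le; apply; exists 2 => //= -[|[|m]]//= _.
  rewrite (le_trans (bnd m))// ler_wpM2l ?mulr_ge0// lerBlDr lerDl.
  by rewrite exprn_ge0.
by rewrite /T opprB addrA addrAC /q (_ : 2 * N ^+ 4 * _ = 2 * N * (N * r) ^+ 3)//; ring.
Qed.

End LogDet.

(** * Even moments of the normal law *)

Section GaussianMoments.
Context {R : realType}.
Notation mu := (@lebesgue_measure R).
Variable s : R.
Hypothesis s0 : 0 < s.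
Let phi : R -> R := normal_pdf 0 s.

Let phiE x : phi x = normal_peak s * expR (- x ^+ 2 / (s ^+ 2 *+ 2)).
Proof. by rewrite /phi normal_pdfE ?gt_eqF// /normal_fun subr0. Qed.

Let phi_cont : continuous phi.
Proof. by apply: continuous_normal_pdf; rewrite gt_eqF. Qed.

Let phi_deriv (x : R) : is_derive x 1 phi (- (x / s ^+ 2) * phi x).
Proof.
have -> : phi = (fun x : R => normal_peak s * expR (- (s ^+ 2 *+ 2)^-1 * x ^+ 2)).
  by apply/funext => y; rewrite phiE; congr (_ * expR _); rewrite !mulNr mulrC.
have D : is_derive x 1 (fun x : R => - (s ^+ 2 *+ 2)^-1 * x ^+ 2)
    (- (s ^+ 2 *+ 2)^-1 * (2 * x)).
  apply: is_derive_eq. rewrite /GRing.scale/=; ring.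
have E : is_derive x 1
    (expR \o (fun x : R => - (s ^+ 2 *+ 2)^-1 * x ^+ 2))
    (expR (- (s ^+ 2 *+ 2)^-1 * x ^+ 2) * (- (s ^+ 2 *+ 2)^-1 * (2 * x))).
  exact: (is_derive1_comp (is_derive_expR _) D).
have -> : - (x / s ^+ 2) * (normal_peak s * expR (- (s ^+ 2 *+ 2)^-1 * x ^+ 2)) =
  normal_peak s * (expR (- (s ^+ 2 *+ 2)^-1 * x ^+ 2) * (- (s ^+ 2 *+ 2)^-1 * (2 * x))).
  by rewrite -mulr_natr; field; rewrite gt_eqF.
exact: (is_deriveZ (normal_peak s) E).
Qed.

(** Bounding the exponential below by its term of degree [k + 1] at [c x^2] gives
    [x^k phi(x) <= C / x] for [x >= 1]. This removes the boundary term at infinity in the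
    integration by parts. *)
Let monomial_phi_cvg0 k : x ^+ k * phi x @[x --> +oo%R] --> 0.
Proof.
pose c : R := (s ^+ 2 *+ 2)^-1.
have c0 : 0 < c by rewrite invr_gt0 pmulrn_lgt0// exprn_gt0.
pose C : R := normal_peak s * k.+1`!%:R / c ^+ k.+1.
have C0 : 0 <= C.
  by rewrite !mulr_ge0 ?normal_peak_ge0// invr_ge0 exprn_ge0// ltW.
have key (x : R) : 1 <= x -> x ^+ k * phi x <= C * x^-1.
  move=> x1; have x0 : 0 < x by exact: lt_le_trans x1.
  have xk0 : 0 < x ^+ k by rewrite exprn_gt0.
  have y0 : 0 < c * x ^+ 2 by rewrite mulr_gt0// exprn_gt0.
  have fk : 0 < k.+1`!%:R :> R by rewrite ltr0n fact_gt0.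
  have : (c * x ^+ 2) ^+ k.+1 / k.+1`!%:R <= expR (c * x ^+ 2).
    by apply: le_trans (expR_ge1Dxn k (ltW y0)); rewrite lerDr.
  move=> H.
  have H' : expR (- x ^+ 2 / (s ^+ 2 *+ 2)) <= k.+1`!%:R / (c * x ^+ 2) ^+ k.+1.
    rewrite mulNr -/c (mulrC _ c) expRN -[leRHS]invf_div lef_pV2 ?posrE ?expR_gt0//.
    by rewrite divr_gt0// exprn_gt0.
  have H2 : (x ^+ 2) ^+ k.+1 = x ^+ k * x * (x ^+ k * x).
    by rewrite -exprM mulnC exprM expr2 [x ^+ _.+1]exprSr.
  rewrite phiE /C mulrCA -!mulrA ler_wpM2l ?normal_peak_ge0//.
  rewrite (le_trans (ler_wpM2l (ltW xk0) H'))//.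
  rewrite exprMn H2 -(@ler_pM2r _ (c ^+ k.+1 * (x ^+ k * x))); last first.
    by rewrite !mulr_gt0// exprn_gt0.
  rewrite [leLHS](_ : _ = k.+1`!%:R / x); last first.
    by field; rewrite !expf_neq0 ?gt_eqF.
  rewrite [leRHS](_ : _ = k.+1`!%:R * x ^+ k); last first.
    by field; rewrite ?expf_neq0 ?gt_eqF.
  rewrite ler_pM2l//; apply: (@le_trans _ _ 1); first by rewrite invf_le1.
  by rewrite exprn_ege1.
apply: (@squeeze_cvgr _ _ _ _ (fun=> 0) (fun x => C * x^-1)).
- near=> x; have x1 : 1 <= x by near: x; exact: nbhs_pinfty_ge.
  have x0 : 0 <= x by lra.
  by rewrite key// andbT mulr_ge0 ?normal_pdf_ge0// exprn_ge0.
- exact: cvg_cst.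
- rewrite -[X in _ --> X](mulr0 C); apply: cvgM; first exact: cvg_cst.
  apply/gtr0_cvgV0; last exact: cvg_id.
  by near=> x; near: x; exact: nbhs_pinfty_gt.
Unshelve. all: by end_near. Qed.

(** [F] is the distribution function shifted to vanish at 0. It converges because it is monotone and
    bounded; evenness and total mass 1 identify the limit. *)
Lemma half_gauss_antideriv0 : exists F : R -> R,
  [/\ F x @[x --> +oo%R] --> (2^-1 : R),
   F 0 = 0 & forall x : R, is_derive x 1 F (phi x)].
Proof.
pose G x := (\int[mu]_(t in `]-oo, x]) phi t)%R.
have phi_int A : measurable A -> mu.-integrable A (EFin \o phi).
  by move=> mA; apply: (integrableS measurableT) => //; exact: integrable_normal_pdf.
have phi_mono A B : measurable A -> measurable B -> A `<=` B ->
    (\int[mu]_(t in A) phi t <= \int[mu]_(t in B) phi t)%R.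
  move=> mA mB AB; apply: fine_le.
  - by apply: integrable_fin_num => //; exact: phi_int.
  - by apply: integrable_fin_num => //; exact: phi_int.
  apply: ge0_subset_integral => //; first exact: (measurable_int _ (phi_int _ mB)).
  by move=> x _; rewrite lee_fin normal_pdf_ge0.
have Gd (x : R) : is_derive x 1 G (phi x).
  have [||||dG <-] := @continuous_FTC1 R phi -oo%O x (x + 1).
  - by rewrite ltrDl.
  - exact: phi_int.
  - by rewrite ltNyr.
  - exact: phi_cont.
  by rewrite derive1E; exact: DeriveDef.
have Gnd : nondecreasing_fun G.
  by move=> x y xy; apply: phi_mono => //; apply: subset_itvl; rewrite bnd_simp.
have Gub : has_ubound (range G).
  exists (\int[mu]_(t in setT) phi t)%R => _ [x _ <-]; exact: phi_mono.
have /nondecreasing_cvgr/(_ Gub) := Gnd; set l := sup _ => Gl.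
exists (fun x => G x - G 0); split; rewrite ?subrr//; last first.
  move=> x; rewrite -[phi x]subr0.
  by apply: is_deriveB.
suff -> : 2^-1 = l - G 0 by apply: cvgB => //; exact: cvg_cst.
have Gc : continuous G.
  move=> x; apply: differentiable_continuous.
  by apply/derivable1_diffP; have [] := Gd x.
have : (\int[mu]_(x in `[0%R, +oo[) (phi x)%:E = l%:E - (G 0)%:E)%E.
  apply: ge0_continuous_FTC2y => //.
  - by move=> x _; exact: normal_pdf_ge0.
  - exact: continuous_subspaceT.
  - exact: cvg_at_right_filter (Gc 0).
  - by move=> x _; rewrite derive1E; have [_ ->] := Gd x.
have := @ge0_symfun_integralT R phi (normal_pdf_ge0 0 s) phi_cont.
rewrite integral_normal_pdf set_itvcy => H E; move: H; rewrite E.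
have -> : 1%E = (1 : R)%:E by [].
move=> H'; have /H' : phi =1 phi \o -%R by move=> x; rewrite /= !phiE sqrrN.
rewrite -EFinB -EFinM => -[] H2.
by lra.
Qed.

(** Integration by parts on primitives: as [phi' = - x phi / s^2], the primitive for [k + 1] is
    [- s^2 x^(2k+1) phi] plus [(2k+1) s^2] times the one for [k]. A primitive with its limit is what
    the fundamental theorem of calculus on a half-line asks for; the half-line carries half of the
    moment. *)
Lemma half_gauss_antideriv k : exists F : R -> R,
  [/\ F x @[x --> +oo%R] --> (2^-1 : R) * (s ^+ k.*2 * (\prod_(i < k) (i.*2.+1)%:R)),
   F 0 = 0 & forall x : R, is_derive x 1 F (x ^+ k.*2 * phi x)].
Proof.
elim: k => [|k [F [Fl F0 FD]]].
  have [F [Fl F0 FD]] := half_gauss_antideriv0.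
  exists F; split => //; first by rewrite big_ord0 expr0 !mulr1.
  by move=> x; rewrite expr0 mul1r.
exists (fun x => - s ^+ 2 * (x ^+ k.*2.+1 * phi x) + k.*2.+1%:R * s ^+ 2 * F x).
split.
- rewrite [X in _ --> X](_ : _ = - s ^+ 2 * 0 + k.*2.+1%:R * s ^+ 2 *
     (2^-1 * (s ^+ k.*2 * (\prod_(i < k) i.*2.+1%:R)))); last first.
    by rewrite big_ord_recr doubleS !exprS/=; ring.
  by apply: cvgD; apply: cvgM => //; exact: cvg_cst.
- by rewrite F0 expr0n/= mul0r !mulr0 addr0.
move=> x.
have D1 := is_deriveM (is_deriveX k.*2.+1 (is_derive_id x 1)) (phi_deriv x).
have := is_deriveD (is_deriveZ (- s ^+ 2) D1) (is_deriveZ (k.*2.+1%:R * s ^+ 2) (FD x)).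
have -> : id ^+ k.*2.+1 = (fun y : R => y ^+ k.*2.+1).
  by apply/funext => y; rewrite exprfctE.
move=> D; apply: (is_derive_eq D); rewrite /GRing.scale/= doubleS !exprS.
by field; rewrite gt_eqF.
Qed.

(** The Radon-Nikodym derivative is determined only almost everywhere; it agrees there with the
    density because both have the same integral over every measurable set. *)
Lemma integral_normal_prob (f : measurableTypeR R -> \bar R) : (forall x, 0 <= f x)%E ->
  measurable_fun setT f ->
  (\int[normal_prob 0 s]_x f x = \int[mu]_x (f x * (phi x)%:E))%E.
Proof.
move=> f0 mf; have dom := @normal_prob_dominates R 0 s.
rewrite -(Radon_Nikodym_SigmaFinite.change_of_variables dom)//.
have mphi : measurable_fun setT (EFin \o phi).
  by apply/measurable_EFinP; exact: measurable_normal_pdf.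
have mg := Radon_Nikodym_SigmaFinite.f_integrable dom.
apply: ae_eq_integral => //.
- by apply: emeasurable_funM => //; exact: (measurable_int _ mg).
- exact: emeasurable_funM.
apply: ae_eqe_mul2l.
apply: (@integral_ae_eq _ _ _ mu setT measurableT (EFin \o phi) _ mg mphi) => E _ mE.
by rewrite -Radon_Nikodym_SigmaFinite.f_integral.
Qed.

Lemma normal_moment_even k : (\int[normal_prob 0 s]_x (x ^+ k.*2)%:E =
  (s ^+ k.*2 * (\prod_(i < k) (i.*2.+1)%:R))%:E)%E.
Proof.
pose f x := x ^+ k.*2 * phi x.
have x0 (x : R) : 0 <= x ^+ k.*2 by rewrite -muln2 exprM sqr_ge0.
have f0 x : 0 <= f x by rewrite mulr_ge0 ?normal_pdf_ge0.
have fc : continuous f.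
  move=> x; apply: cvgM; last exact: phi_cont.
  exact: exprn_continuous.
rewrite integral_normal_prob; last 2 first.
- by move=> x; rewrite lee_fin.
- by apply/measurable_EFinP; exact: measurable_funX.
transitivity (\int[mu]_x (f x)%:E)%E; first by [].
rewrite ge0_symfun_integralT//; last first.
  by move=> x; rewrite /f /= !phiE sqrrN -muln2 mulnC !exprM sqrrN.
have [F [Fl F0 FD]] := half_gauss_antideriv k.
rewrite -set_itvcy (ge0_continuous_FTC2y (F := F) _ _ Fl)//.
- by rewrite F0 sube0 -EFinM; congr EFin; field.
- exact: continuous_subspaceT.
- apply: cvg_at_right_filter; apply: differentiable_continuous.
  by apply/derivable1_diffP; have [] := FD 0.
- by move=> x _; rewrite derive1E; have [_ ->] := FD x.
Qed.

End GaussianMoments.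

(** * Families that vanish through order dt *)

Section ODt.
Context {R : realType}.
Implicit Types I J : R -> \bar R.

(** On extended reals, the bound by a finite number already forces finiteness near 0. *)
Definition o_dt I := forall e : R, 0 < e ->
  \forall h \near 0^'+, (`|I h| <= (e * h)%:E)%E.

Lemma o_dtP I : ((h^-1)%:E * I h)%E @[h --> 0^'+] --> 0%E <-> o_dt I.
Proof.
split=> [/fine_cvgP[Ifin /cvgrPdist_le I0] e e0|oI].
  near=> h; have h0 : 0 < h by near: h; exact: nbhs_right_gt.
  have : ((h^-1)%:E * I h)%E \is a fin_num by near: h; exact: Ifin.
  have : `|0 - fine ((h^-1)%:E * I h)%E| <= e by near: h; exact: I0.
  case: (I h) => [r| |] /=; last 2 first.
  - by move=> _; rewrite gt0_muley// lte_fin invr_gt0.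
  - by move=> _; rewrite gt0_muleNy// lte_fin invr_gt0.
  rewrite sub0r normrN normrM gtr0_norm ?invr_gt0// => H _.
  by rewrite lee_fin -ler_pdivrMr// mulrC.
apply/fine_cvgP; split.
  near=> h; have h0 : 0 < h by near: h; exact: nbhs_right_gt.
  have : (`|I h| <= (1 * h)%:E)%E by near: h; exact: oI.
  by case: (I h).
apply/cvgrPdist_le => e e0.
near=> h; have h0 : 0 < h by near: h; exact: nbhs_right_gt.
have : (`|I h| <= (e * h)%:E)%E by near: h; exact: oI.
rewrite /=; case: (I h) => [r| |] //=; rewrite lee_fin => H.
by rewrite sub0r normrN normrM gtr0_norm ?invr_gt0// mulrC ler_pdivrMr.
Unshelve. all: by end_near. Qed.

Lemma o_dt_le I J : (\forall h \near 0^'+, (`|I h| <= J h)%E) -> o_dt J -> o_dt I.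
Proof.
move=> IJ oJ e e0; near=> h.
apply: (@le_trans _ _ (J h)); first by near: h.
apply: (@le_trans _ _ `|J h|%E); first exact: lee_abs.
by near: h; exact: oJ.
Unshelve. all: by end_near. Qed.

Lemma o_dt_eq I J : (\forall h \near 0^'+, I h = J h) -> o_dt J -> o_dt I.
Proof. by move=> IJ oJ e e0; apply: filterS2 IJ (oJ e e0) => h ->. Qed.

Lemma o_dtD I J : o_dt I -> o_dt J -> o_dt (fun h => I h + J h)%E.
Proof.
move=> oI oJ e e0; have e2 : 0 < e / 2 by rewrite divr_gt0.
near=> h; apply: le_trans (lee_abs_add _ _) _.
rewrite (splitr e) mulrDl EFinD; apply: leeD; near: h; [exact: oI|exact: oJ].
Unshelve. all: by end_near. Qed.

Lemma o_dtZ (c : R) I : o_dt I -> o_dt (fun h => c%:E * I h)%E.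
Proof.
move=> oI e e0; have c0 : 0 < `|c| + 1 by rewrite ltr_wpDl.
have ec : 0 < e / (`|c| + 1) by rewrite divr_gt0.
near=> h; have h0 : 0 < h by near: h; exact: nbhs_right_gt.
have : (`|I h| <= (e / (`|c| + 1) * h)%:E)%E by near: h; exact: oI.
case: (I h) => [r| |] //=; rewrite !lee_fin => H.
rewrite normrM (le_trans (ler_wpM2l (normr_ge0 c) H))//.
rewrite mulrA ler_wpM2r ?(ltW h0)// mulrA ler_pdivrMr// mulrC ler_wpM2l//.
  exact: ltW.
by rewrite lerDl.
Unshelve. all: by end_near. Qed.

Lemma o_dt_h_sqrt (c : R) : o_dt (fun h => (c * (h * Num.sqrt h))%:E).
Proof.
move=> e e0; have c0 : 0 < `|c| + 1 by rewrite ltr_wpDl.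
near=> h; have h0 : 0 < h by near: h; exact: nbhs_right_gt.
have hs : h < (e / (`|c| + 1)) ^+ 2.
  by near: h; apply: nbhs_right_lt; rewrite exprn_gt0// divr_gt0.
rewrite lee_fin normrM [`|h * _|]ger0_norm; last first.
  by rewrite mulr_ge0 ?sqrtr_ge0// ltW.
have sh : Num.sqrt h <= e / (`|c| + 1).
  have e1 : 0 < e / (`|c| + 1) by rewrite divr_gt0.
  by rewrite -[leRHS](gtr0_norm e1) -sqrtr_sqr ler_wsqrtr// ltW.
rewrite mulrCA mulrC ler_wpM2r ?(ltW h0)//.
rewrite (le_trans (ler_wpM2l (normr_ge0 c) sh))// mulrA ler_pdivrMr// mulrC.
by rewrite ler_wpM2l ?ltW// ltrDl.
Unshelve. all: by end_near. Qed.

(** Coefficients are shown to vanish in this way once an expectation has been computed exactly. *)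
Lemma o_dt_linear (c : R) : o_dt (fun h => (c * h)%:E) -> c = 0.
Proof.
move=> oc; apply/eqP; rewrite -normr_eq0; apply/eqP/le_anti.
rewrite normr_ge0 andbT; apply/ler_addgt0Pr => e e0; rewrite add0r.
near (0 : R)^'+ => h; have h0 : 0 < h by near: h; exact: nbhs_right_gt.
have : (`|(c * h)%:E| <= (e * h)%:E)%E by near: h; exact: oc.
by rewrite lee_fin normrM (gtr0_norm h0) ler_pM2r.
Unshelve. all: by end_near. Qed.

End ODt.

Section Negligible.
Context {R : realType} {dsp : measure_display} {Omega : measurableType dsp}.
Variable P : probability Omega R.
Implicit Types (f g Z : R -> Omega -> R) (G D : R -> set Omega).

Local Notation E X := (\int[P]_w (X w)%:E)%E.

(** Smallness in L^1: unlike a mean that is merely o(h), it passes to every dominated family. *)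
Definition small f :=
  (\forall h \near 0^'+, measurable_fun setT (f h) /\ forall w, 0 <= f h w) /\
  o_dt (fun h => E (f h)).

Lemma le_abs_expectation (X Y : Omega -> R) :
  measurable_fun setT X -> measurable_fun setT Y ->
  (forall w, `|X w| <= Y w) -> (`|E X| <= E Y)%E.
Proof.
move=> mX mY XY; apply: le_trans (le_abse_integral _ _ _) _ => //.
  exact/measurable_EFinP.
apply: ge0_le_integral => //.
- by apply: measurableT_comp => //; exact/measurable_EFinP.
- exact/measurable_EFinP.
- by move=> w _; rewrite lee_fin.
Qed.

Lemma small_dominated f g : small g ->
  (\forall h \near 0^'+, measurable_fun setT (f h) /\ forall w, `|f h w| <= g h w) ->
  o_dt (fun h => E (f h)).
Proof.
move=> [mg og] fg; apply: o_dt_le og; near=> h.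
have [mf flg] : measurable_fun setT (f h) /\ forall w, `|f h w| <= g h w by near: h.
have [mgh _] : measurable_fun setT (g h) /\ forall w, 0 <= g h w by near: h.
exact: le_abs_expectation.
Unshelve. all: by end_near. Qed.

Lemma small_le f g : small g ->
  (\forall h \near 0^'+,
    [/\ measurable_fun setT (f h), forall w, 0 <= f h w & forall w, f h w <= g h w]) ->
  small f.
Proof.
move=> sg fg; split; first by apply: filterS fg => h [].
apply: (small_dominated sg); apply: filterS fg => h [mf f0 flg]; split => // w.
by rewrite ger0_norm.
Qed.

Lemma smallD f g : small f -> small g -> small (fun h w => f h w + g h w).
Proof.
move=> [mf of_] [mg og]; split.
  apply: filterS2 mf mg => h [mf f0] [mg g0]; split; first exact: measurable_funD.
  by move=> w; rewrite addr_ge0.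
apply: o_dt_le (o_dtD of_ og); apply: filterS2 mf mg => h [mf f0] [mg g0].
rewrite -ge0_integralD//; last 4 first.
- by move=> w _; rewrite lee_fin.
- exact/measurable_EFinP.
- by move=> w _; rewrite lee_fin.
- exact/measurable_EFinP.
by rewrite gee0_abs// integral_ge0// => w _; rewrite lee_fin addr_ge0.
Qed.

Lemma smallZ (c : R) f : 0 <= c -> small f -> small (fun h w => c * f h w).
Proof.
move=> c0 [mf of_]; split.
  apply: filterS mf => h [mf f0]; split; first exact: measurable_funM.
  by move=> w; rewrite mulr_ge0.
apply: o_dt_le (o_dtZ c of_); apply: filterS mf => h [mf f0].
rewrite -ge0_integralZl//; last 2 first.
- exact/measurable_EFinP.
- by move=> w _; rewrite lee_fin.
by rewrite gee0_abs// integral_ge0// => w _; rewrite lee_fin mulr_ge0.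
Qed.

(** A mean that is o(h) is eventually below [h], hence finite; this licenses splitting integrals of
    differences. *)
Lemma small_integrable f : small f ->
  \forall h \near 0^'+, P.-integrable setT (EFin \o f h).
Proof.
move=> [mf of_]; near=> h.
have [mfh f0] : measurable_fun setT (f h) /\ forall w, 0 <= f h w by near: h.
have fin : (`|E (f h)| <= (1 * h)%:E)%E by near: h; exact: of_.
apply/integrableP; split; first exact/measurable_EFinP.
rewrite (_ : (\int[P]_w _)%E = E (f h)); last first.
  by apply: eq_integral => w _; rewrite /= ger0_norm.
by rewrite (le_lt_trans (lee_abs _))// (le_lt_trans fin)// ltry.
Unshelve. all: by end_near. Qed.

(** Extension by zero, so that families living on different events can be subtracted under one
    integral. *)
Definition ind (A : set Omega) (X : Omega -> R) w : R :=
  if w \in A then X w else 0.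

Lemma integral_ind A X : (\int[P]_(w in A) (X w)%:E = E (ind A X))%E.
Proof.
rewrite integral_mkcond; apply: eq_integral => w _.
by rewrite patchE /ind; case: ifP.
Qed.

Lemma measurable_ind A X : measurable A -> measurable_fun A X ->
  measurable_fun setT (ind A X).
Proof.
move=> mA mX; have -> : ind A X = X \_ A by [].
by apply/measurable_restrict => //; rewrite setTI.
Qed.

(** Its expectation is the probability of the exceptional event, which thus enters estimates as one
    more small family. *)
Definition bad G h : Omega -> R := \1_(~` G h).

Lemma ito_negligibleP D Z : ito_negligible P D Z <-> exists G,
  [/\ (\forall h \near 0^'+,
        [/\ measurable (G h), G h `<=` D h & measurable_fun (G h) (Z h)]),
      small (bad G), o_dt (fun h => E (ind (G h) (Z h))) &
      small (fun h w => ind (G h) (Z h) w ^+ 2)].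
Proof.
have indX A (X : Omega -> R) : ind A (fun w => X w ^+ 2) = (fun w => ind A X w ^+ 2).
  by apply/funext => w; rewrite /ind; case: ifP; rewrite ?expr0n.
have e1 G : (fun h => E (ind (G h) (Z h))) =
    (fun h => \int[P]_(w in G h) (Z h w)%:E)%E.
  by apply/funext => h; rewrite [RHS]integral_ind.
have e2 G : (fun h => E (fun w => ind (G h) (Z h) w ^+ 2)) =
    (fun h => \int[P]_(w in G h) ((Z h w) ^+ 2)%:E)%E.
  by apply/funext => h; rewrite [RHS]integral_ind indX.
split=> -[G [mG]].
  move=> /o_dtP bG /o_dtP EZ /o_dtP EZ2; exists G; split => //.
  - split.
      apply: filterS mG => h [mG _ _]; split => [|w]; last by rewrite /bad indicE.
      by apply: measurable_indic; exact: measurableC.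
    apply: o_dt_le bG; apply: filterS mG => h [mG _ _].
    rewrite integral_indic//; last exact: measurableC.
    by rewrite setIT gee0_abs.
  - by rewrite e1.
  - split.
      apply: filterS mG => h [mG _ mZ]; split => [|w]; last exact: sqr_ge0.
      by apply: measurable_funX; exact: measurable_ind.
    by rewrite e2.
move=> [_ bG] EZ [_ EZ2]; exists G; split => //; apply/o_dtP.
- apply: o_dt_le bG; apply: filterS mG => h [mG _ _].
  rewrite integral_indic//; last exact: measurableC.
  by rewrite setIT gee0_abs.
- by rewrite -e1.
- by rewrite -e2.
Qed.

End Negligible.

(** * Moments of Brownian increments and the common majorant *)

Section Brownian.
Context {R : realType} {dsp : measure_display} {Omega : measurableType dsp}.
Variables (P : probability Omega R) (W : R -> {RV P >-> R}) (t : R).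
Hypotheses (HW : standard_brownian W) (t0 : 0 <= t).

Local Notation E X := (\int[P]_w (X w)%:E)%E.
Local Notation B := (dB W t).

Lemma measurable_dB h : measurable_fun setT (B h).
Proof. by apply: measurable_funB; exact: measurable_funP. Qed.

Lemma expectation_cst (c : R) : E (fun=> c) = c%:E.
Proof.
rewrite integral_cst//; transitivity (c%:E * 1)%E; last by rewrite mule1.
by congr (_ * _)%E; exact: probability_setT.
Qed.

(** The law of the increment is normal with standard deviation [sqrt h], and the moment is computed
    against that law by pushforward. The product is the double factorial (2k-1)!!: 1 for the
    variance, 3 for the fourth moment. *)
Lemma dB_moment_even k h : 0 < h ->
  E (fun w => B h w ^+ k.*2) = (h ^+ k * \prod_(i < k) (i.*2.+1)%:R)%:E.
Proof.
move=> h0; have [_ _ Wnormal _] := HW.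
have x0 (x : R) : 0 <= x ^+ k.*2 by rewrite -muln2 exprM sqr_ge0.
have sh : 0 < Num.sqrt h by rewrite sqrtr_gt0.
have -> : h ^+ k = Num.sqrt h ^+ k.*2.
  by rewrite -mul2n exprM sqr_sqrtr// ltW.
rewrite -(normal_moment_even sh).
have mX : measurable_fun [set: measurableTypeR R] (fun x : R => (x ^+ k.*2)%:E).
  by apply/measurable_EFinP; exact: measurable_funX.
pose Y : Omega -> measurableTypeR R := B h.
have mY : measurable_fun setT Y by exact: measurable_dB.
pose Ymfun := isMeasurableFun.Build _ _ _ _ Y mY.
pose X : {mfun Omega >-> measurableTypeR R} := HB.pack Y Ymfun.
transitivity (\int[pushforward P X]_x (x ^+ k.*2)%:E)%E.
  by rewrite (ge0_integral_pushforward mY)// => x _; rewrite lee_fin.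
apply: eq_measure_integral => A mA _.
have := Wnormal t (t + h) t0 _ A mA; rewrite ltrDl => /(_ h0).
rewrite [t + h - t]addrC addKr => EA.
exact: EA.
Qed.

(* With b^2 of size h, all the terms below are of size h^(3/2). *)
Definition dom (h b : R) : R :=
  b ^+ 4 / Num.sqrt h + Num.sqrt h * b ^+ 2 + h * Num.sqrt h.

Lemma dom_ge0 h b : 0 < h -> 0 <= dom h b.
Proof.
move=> h0; rewrite /dom; apply: addr_ge0; [apply: addr_ge0|]; apply: mulr_ge0.
- exact: exprn_even_ge0.
- by rewrite invr_ge0 sqrtr_ge0.
- exact: sqrtr_ge0.
- exact: sqr_ge0.
- exact: ltW.
- exact: sqrtr_ge0.
Qed.

Lemma small_dom : small P (fun h w => dom h (B h w)).
Proof.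
split.
  near=> h; have h0 : 0 < h by near: h; exact: nbhs_right_gt.
  split => [|w]; last exact: dom_ge0.
  apply: measurable_funD => //; apply: measurable_funD.
    by apply: measurable_funM => //; apply: measurable_funX; exact: measurable_dB.
  by apply: measurable_funM => //; apply: measurable_funX; exact: measurable_dB.
apply: o_dt_le (o_dt_h_sqrt 5); near=> h.
have h0 : 0 < h by near: h; exact: nbhs_right_gt.
have s0 : 0 < Num.sqrt h by rewrite sqrtr_gt0.
have mB k : measurable_fun setT (fun w => (B h w ^+ k)%:E).
  by apply/measurable_EFinP/measurable_funX; exact: measurable_dB.
(* The three means are [3 h^2 / sqrt h], [sqrt h * h] and [h * sqrt h]. *)
have -> : E (fun w => dom h (B h w)) = (5 * (h * Num.sqrt h))%:E.
  have -> : E (fun w => dom h (B h w)) = (\int[P]_w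
     ((((Num.sqrt h)^-1)%:E * (B h w ^+ 4)%:E +
       (Num.sqrt h)%:E * (B h w ^+ 2)%:E) + (h * Num.sqrt h)%:E))%E.
    apply: eq_integral => w _; rewrite /dom -!EFinM -!EFinD; congr (_ + _ + _)%:E.
    exact: mulrC.
  have B4 w : 0 <= B h w ^+ 4 by exact: exprn_even_ge0.
  have i0 : 0 <= (Num.sqrt h)^-1 by rewrite invr_ge0 ltW.
  have m4 : measurable_fun setT (fun w => ((Num.sqrt h)^-1)%:E * (B h w ^+ 4)%:E)%E.
    exact: emeasurable_funM.
  have m2 : measurable_fun setT (fun w => (Num.sqrt h)%:E * (B h w ^+ 2)%:E)%E.
    exact: emeasurable_funM.
  rewrite ge0_integralD//; last 3 first.
  - by move=> w _; rewrite -!EFinM -EFinD lee_fin addr_ge0// mulr_ge0 ?sqr_ge0// ltW.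
  - exact: emeasurable_funD.
  - by move=> w _; rewrite lee_fin mulr_ge0// ltW.
  rewrite ge0_integralD//; last 2 first.
  - by move=> w _; rewrite -!EFinM lee_fin mulr_ge0.
  - by move=> w _; rewrite -!EFinM lee_fin mulr_ge0 ?sqr_ge0// ltW.
  rewrite !ge0_integralZl//; last 2 first.
  - by move=> w _; rewrite lee_fin sqr_ge0.
  - by move=> w _; rewrite lee_fin B4.
  rewrite (dB_moment_even 2 h0) (dB_moment_even 1 h0) expectation_cst.
  rewrite -!EFinM -!EFinD; congr EFin.
  have p2 : \prod_(i < 2) (i.*2.+1)%:R = 3 :> R.
    by rewrite !big_ord_recr big_ord0/= !mul1r.
  have hE : h = Num.sqrt h * Num.sqrt h by rewrite -expr2 sqr_sqrtr// ltW.
  rewrite p2 big_ord1 mulr1 expr1 expr2.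
  move: (Num.sqrt h) s0 hE => q q0 ->; field.
  by rewrite gt_eqF.
by rewrite gee0_abs// lee_fin !mulr_ge0// ltW.
Unshelve. all: by end_near. Qed.

Lemma integrable_dB_sqr h : 0 < h -> P.-integrable setT (fun w => (B h w ^+ 2)%:E).
Proof.
move=> h0; apply/integrableP; split.
  by apply/measurable_EFinP/measurable_funX; exact: measurable_dB.
rewrite (_ : (\int[P]_w _)%E = E (fun w => B h w ^+ 2)).
  by rewrite (dB_moment_even 1 h0) ltry.
by apply: eq_integral => w _; rewrite /= ger0_norm ?sqr_ge0.
Qed.

Lemma integrable_dB_sqr_sub h : 0 < h ->
  P.-integrable setT (fun w => (B h w ^+ 2 - h)%:E).
Proof.
move=> h0.
have -> : (fun w => (B h w ^+ 2 - h)%:E) =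
    ((fun w => (B h w ^+ 2)%:E) \- cst h%:E)%E by [].
apply: integrableB => //; first exact: integrable_dB_sqr.
exact: finite_measure_integrable_cst.
Qed.

Lemma expectation_dB_sqr_sub h : 0 < h -> E (fun w => B h w ^+ 2 - h) = 0%E.
Proof.
move=> h0.
have -> : E (fun w => B h w ^+ 2 - h) = (\int[P]_w ((B h w ^+ 2)%:E - (cst h%:E w)))%E.
  by apply: eq_integral => w _; rewrite EFinB.
rewrite integralB//; last exact: finite_measure_integrable_cst.
  by rewrite expectation_cst (dB_moment_even 1 h0) big_ord1 mulr1 expr1 subee.
exact: integrable_dB_sqr.
Qed.

End Brownian.

(** * Negligibility from a pathwise Taylor estimate *)

Section TaylorNegligible.
Context {R : realType} {dsp : measure_display} {Omega : measurableType dsp}.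
Variables (P : probability Omega R) (W : R -> {RV P >-> R}) (t : R).
Hypotheses (HW : standard_brownian W) (t0 : 0 <= t).

Local Notation E X := (\int[P]_w (X w)%:E)%E.
Local Notation B := (dB W t).

(** Acts as a Markov inequality of order four: where [|b| > delta], the constant [delta^4] is below
    [dom], so leaving the ball has probability o(h). *)
Lemma pow4_le_dom (h b : R) : 0 < h <= 1 -> b ^+ 4 <= dom h b.
Proof.
move=> /andP[h0 h1]; have q0 : 0 < Num.sqrt h by rewrite sqrtr_gt0.
have q1 : Num.sqrt h <= 1 by rewrite -sqrtr1 ler_wsqrtr.
have b4 : 0 <= b ^+ 4 by exact: exprn_even_ge0.
have : b ^+ 4 <= b ^+ 4 / Num.sqrt h by rewrite ler_pdivlMr// ler_piMr.
have : 0 <= Num.sqrt h * b ^+ 2 by rewrite mulr_ge0 ?sqr_ge0// ltW.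
have : 0 <= h * Num.sqrt h by rewrite mulr_ge0 ?ltW.
by rewrite /dom; lra.
Qed.

Lemma sqr_h_le_dom (h b : R) : 0 < h <= 1 -> h ^+ 2 <= dom h b.
Proof.
move=> /andP[h0 h1]; have q0 : 0 < Num.sqrt h by rewrite sqrtr_gt0.
have hE : Num.sqrt h ^+ 2 = h by rewrite sqr_sqrtr// ltW.
have q1 : Num.sqrt h <= 1 by rewrite -sqrtr1 ler_wsqrtr.
have : 0 <= b ^+ 4 / Num.sqrt h.
  by rewrite divr_ge0 ?(ltW q0)//; exact: exprn_even_ge0.
have : 0 <= Num.sqrt h * b ^+ 2 by rewrite mulr_ge0 ?sqr_ge0// ltW.
have : h ^+ 2 <= h * Num.sqrt h.
  by rewrite expr2 ler_wpM2l ?(ltW h0)// -[leLHS]hE expr2 ler_piMr// ltW.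
by rewrite /dom; lra.
Qed.

(* AM-GM with q = sqrt h: 2|b|^3 <= b^4/q + q b^2 and 2 h |b| <= q b^2 + q^3. *)
Lemma cubic_le_dom (h b : R) : 0 < h <= 1 ->
  (`|b| + h) * (b ^+ 2 + h) <= 2 * dom h b.
Proof.
move=> /andP[h0 h1]; have q0 : 0 < Num.sqrt h by rewrite sqrtr_gt0.
have q1 : Num.sqrt h <= 1 by rewrite -sqrtr1 ler_wsqrtr.
have hE : h = Num.sqrt h ^+ 2 by rewrite sqr_sqrtr// ltW.
rewrite /dom -(real_normK (num_real b)) -[4%N]/(2 * 2)%N exprM.
rewrite -(real_normK (num_real b)).
move: `|b| (normr_ge0 b) => y y0; move: (Num.sqrt h) q0 q1 hE => q q0 q1 ->.
pose r := y ^+ 2 ^+ 2 / q.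
have r0 : 0 <= r by rewrite divr_ge0 ?exprn_ge0 ?sqr_ge0// ltW.
have i1 : 2 * y ^+ 3 <= r + q * y ^+ 2.
  rewrite -subr_ge0 (_ : _ - _ = (y ^+ 2 - q * y) ^+ 2 / q).
    by rewrite divr_ge0 ?sqr_ge0// ltW.
  by rewrite /r; field; rewrite gt_eqF.
have i2 : 2 * (q ^+ 2 * y) <= q * y ^+ 2 + q ^+ 3.
  rewrite -subr_ge0 (_ : _ - _ = q * (y - q) ^+ 2); last by ring.
  by rewrite mulr_ge0 ?sqr_ge0// ltW.
have i3 : q ^+ 2 * y ^+ 2 <= q * y ^+ 2.
  by rewrite ler_wpM2r ?sqr_ge0// expr2 ler_piMr// ltW.
have i4 : q ^+ 4 <= q ^+ 3 by rewrite exprS ler_piMl ?exprn_ge0// ltW.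
have q3 : 0 <= q ^+ 3 by rewrite exprn_ge0// ltW.
have -> : (y + q ^+ 2) * (y ^+ 2 + q ^+ 2) =
  y ^+ 3 + q ^+ 2 * y + q ^+ 2 * y ^+ 2 + q ^+ 4 by ring.
have -> : q ^+ 2 * q = q ^+ 3 by ring.
rewrite -/r; lra.
Qed.

(** One criterion for all comparisons: [c = 0] for the Hencky traces, [c = tr (A^2) / 2] for the Ito
    form. The term [c (b^2 - h)] is of first order, but its mean is zero and its second moment is of
    order [h^2]. Measurability of [z] is required on the ball only, since [mxlog] is controlled only
    there. *)
Lemma ito_negligible_taylor (D : R -> set Omega) (Z : R -> Omega -> R)
    (z : R -> R -> R) (c K dl : R) :
  0 < dl <= 1 -> 0 <= K ->
  (forall h w, Z h w = z h (B h w)) ->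
  (forall h, 0 < h <= dl -> measurable_fun [set b : R | `|b| <= dl] (z h)) ->
  (forall h b, 0 < h <= dl -> `|b| <= dl ->
     `|z h b + c * (b ^+ 2 - h)| <= K * ((`|b| + h) * (b ^+ 2 + h))) ->
  (forall h w, 0 < h <= dl -> `|B h w| <= dl -> D h w) ->
  ito_negligible P D Z.
Proof.
move=> /andP[dl0 dl1] K0 Zz mz zb BD; apply/ito_negligibleP.
pose G h := [set w | `|B h w| <= dl].
have mset : measurable [set b : R | `|b| <= dl].
  by rewrite -[X in measurable X]setTI; apply: measurable_fun_le.
have mG h : measurable (G h).
  rewrite (_ : G h = setT `&` B h @^-1` [set b : R | `|b| <= dl]); last by rewrite setTI.
  exact: measurable_dB.
have near_h : \forall h \near (0 : R)^'+, 0 < h <= dl.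
  near=> h; apply/andP; split; near: h; [exact: nbhs_right_gt|].
  exact: nbhs_right_le.
have near_h1 : \forall h \near (0 : R)^'+, 0 < h <= 1.
  by apply: filterS near_h => h /andP[-> /le_trans]; exact.
have mZ h : 0 < h <= dl -> measurable_fun (G h) (Z h).
  move=> hd; rewrite (_ : Z h = z h \o B h); last by apply/funext => w; exact: Zz.
  apply: (measurable_comp mset) => //; first by move=> _ [w ? <-].
    exact: mz.
  by apply: measurable_funTS; exact: measurable_dB.
have mf h : 0 < h <= dl -> measurable_fun setT (ind (G h) (Z h)).
  by move=> hd; apply: measurable_ind => //; exact: mZ.
have sdom := small_dom HW t0.
have dl4 : 0 < dl ^+ 4 by rewrite exprn_gt0.
have mb4 b : dl < `|b| -> dl ^+ 4 <= b ^+ 4.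
  move=> /ltW db; rewrite -[b ^+ 4]ger0_norm ?exprn_even_ge0// normrX.
  by rewrite lerXn2r// nnegrE ltW.
have notG h w : w \notin G h -> dl < `|B h w|.
  by move=> /negP; rewrite inE /G/= => /negP; rewrite -ltNge.
exists G; split.
- by apply: filterS near_h => h hd; split; [exact: mG|move=> w; exact: BD|exact: mZ].
- apply: (@small_le _ _ _ _ _ (fun h w => (dl ^+ 4)^-1 * dom h (B h w))).
    by apply: smallZ => //; rewrite invr_ge0 ltW.
  apply: filterS near_h1 => h h1; split.
  + by apply: measurable_indic; exact: measurableC.
  + by move=> w; rewrite /bad indicE.
  + move=> w; rewrite /bad indicE in_setC; case: (boolP (w \in G h)) => wG /=.
      by rewrite mulr_ge0 ?invr_ge0 ?(ltW dl4)// dom_ge0; case/andP: h1.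
    rewrite -ler_pdivrMl ?invr_gt0// invrK mulr1.
    by rewrite (le_trans (mb4 _ (notG _ _ wG)))// pow4_le_dom.
(* The compensator is added on the whole space, where its mean vanishes. On [G h] the Taylor
   hypothesis bounds [f]; off [G h] only the compensator remains, and [dl^4 <= B^4] bounds it. These
   are the two summands of [M]. *)
- pose f h w := ind (G h) (Z h) w + c * (B h w ^+ 2 - h).
  pose M := 2 * K + 2 * `|c| / dl ^+ 4.
  have M0 : 0 <= M.
    apply: addr_ge0; first by rewrite mulr_ge0.
    by apply: divr_ge0; [rewrite mulr_ge0|exact: ltW].
  have mf' h : 0 < h <= dl -> measurable_fun setT (f h).
    move=> hd; apply: measurable_funD; first exact: mf.
    apply: measurable_funM => //; apply: measurable_funB => //.
    by apply: measurable_funX; exact: measurable_dB.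
  have fM h w : 0 < h <= dl -> `|f h w| <= M * dom h (B h w).
    move=> hd; have h1 : 0 < h <= 1 by case/andP: hd => -> /le_trans; exact.
    have h0 : 0 < h by case/andP: hd.
    have d0 := dom_ge0 (B h w) h0.
    rewrite /f /ind; case: (boolP (w \in G h)) => wG.
      rewrite Zz (le_trans (zb _ _ hd _))//; first by move: wG; rewrite inE.
      rewrite (le_trans (ler_wpM2l K0 (cubic_le_dom _ h1)))//.
      rewrite mulrA [K * 2]mulrC ler_wpM2r// lerDl.
      by apply: divr_ge0; [rewrite mulr_ge0|exact: ltW].
    rewrite add0r normrM /M mulrDl.
    have b1 := mb4 _ (notG _ _ wG); have b2 := pow4_le_dom (B h w) h1.
    have b3 : dl ^+ 2 <= B h w ^+ 2.
      rewrite -(real_normK (num_real (B h w))) lerXn2r ?nnegrE ?(ltW dl0)//.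
      exact/ltW/notG.
    have b5 : `|B h w ^+ 2 - h| <= 2 / dl ^+ 4 * dom h (B h w).
      have i1 : `|B h w ^+ 2 - h| <= B h w ^+ 2 + h.
        rewrite (le_trans (ler_normB _ _))//.
        by rewrite !ger0_norm ?sqr_ge0// ltW.
      rewrite (le_trans i1)// mulrAC ler_pdivlMr//.
      have : B h w ^+ 2 * dl ^+ 4 <= B h w ^+ 4.
        rewrite -[B h w ^+ 4]/(B h w ^+ (2 + 2)) (exprD (B h w)).
        rewrite ler_wpM2l ?sqr_ge0// (le_trans _ b3)//.
        by rewrite ler_wiXn2l ?(ltW dl0).
      have : h * dl ^+ 4 <= dl ^+ 4 by rewrite ler_piMl ?(ltW dl4)//; case/andP: h1.
      by rewrite mulrDl; lra.
    have := ler_wpM2l (normr_ge0 c) b5.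
    rewrite [leRHS](_ : _ = 2 * `|c| / dl ^+ 4 * dom h (B h w)); last by ring.
    by move=> H; rewrite (le_trans H)// lerDr !mulr_ge0.
  have of_ : o_dt (fun h => E (f h)).
    apply: (small_dominated (smallZ M0 sdom)).
    by apply: filterS near_h => h hd; split; [exact: mf'|move=> w; exact: fM].
  apply: o_dt_eq of_; near=> h; have hd : 0 < h <= dl by near: h.
  have h0 : 0 < h by case/andP: hd.
  have dint : P.-integrable setT (EFin \o (fun w => M * dom h (B h w))).
    by near: h; exact: small_integrable (smallZ M0 sdom).
  have fint : P.-integrable setT (EFin \o f h).
    apply: (le_integrable measurableT _ _ dint).
      by apply/measurable_EFinP; exact: mf'.
    by move=> w _; rewrite lee_fin (le_trans (fM _ _ hd)) ?ler_norm.
  have kint : P.-integrable setT (EFin \o (fun w => c * (B h w ^+ 2 - h))).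
    exact: (integrableZl measurableT c (integrable_dB_sqr_sub HW t0 h0)).
  have kE : E (fun w => c * (B h w ^+ 2 - h)) = 0%E.
    transitivity (\int[P]_w (c%:E * (B h w ^+ 2 - h)%:E))%E; first by [].
    rewrite integralZl//; last exact: integrable_dB_sqr_sub.
    by rewrite expectation_dB_sqr_sub// mule0.
  have -> : E (ind (G h) (Z h)) = (E (f h) - E (fun w => c * (B h w ^+ 2 - h))%R)%E.
    rewrite -integralB//; apply: eq_integral => w _.
    by rewrite -EFinB /f addrK.
  by rewrite kE sube0.
(* On [G h], [|Z| <= (|c| + 2 K) (B^2 + h)] because [|B| + h <= 2], and
   [(B^2 + h)^2 <= 2 B^4 + 2 h^2 <= 4 dom]. *)
have M0 : 0 <= 4 * (`|c| + 2 * K) ^+ 2 by rewrite mulr_ge0 ?sqr_ge0.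
apply: small_le (smallZ M0 sdom) _; apply: filterS near_h => h hd; split.
- by apply: measurable_funX; exact: mf.
- by move=> w; exact: sqr_ge0.
move=> w; have h1 : 0 < h <= 1 by case/andP: hd => -> /le_trans; exact.
have h0 : 0 < h by case/andP: hd.
rewrite /ind; case: (boolP (w \in G h)) => wG; last first.
  by rewrite expr0n mulr_ge0 ?dom_ge0.
have Bd : `|B h w| <= dl by move: wG; rewrite inE.
have b0 : 0 <= B h w ^+ 2 by exact: sqr_ge0.
have i1 : `|Z h w| <= (`|c| + 2 * K) * (B h w ^+ 2 + h).
  rewrite -[Z h w](addrK (c * (B h w ^+ 2 - h))) (le_trans (ler_normB _ _))//.
  have zz := zb _ _ hd Bd; rewrite -Zz in zz.
  apply: le_trans (lerD zz (lexx _)) _; rewrite [leLHS]addrC [leRHS]mulrDl; apply: lerD.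
    rewrite normrM ler_wpM2l// (le_trans (ler_normB _ _))//.
    by rewrite !ger0_norm// ltW.
  have b2 : `|B h w| + h <= 2 by case/andP: h1 => _ h1; lra.
  rewrite [2 * K]mulrC -mulrA ler_wpM2l//; apply: ler_wpM2r => //.
  by rewrite addr_ge0// ltW.
rewrite -[Z h w ^+ 2]ger0_norm ?sqr_ge0// normrX.
apply: le_trans (_ : ((`|c| + 2 * K) * (B h w ^+ 2 + h)) ^+ 2 <= _).
  by rewrite lerXn2r ?nnegrE// (le_trans _ i1).
rewrite exprMn [leRHS](_ : _ = (`|c| + 2 * K) ^+ 2 * (4 * dom h (B h w))); last by ring.
apply: ler_wpM2l; first exact: sqr_ge0.
have := pow4_le_dom (B h w) h1; have := sqr_h_le_dom (B h w) h1.
rewrite -[B h w ^+ 4]/(B h w ^+ (2 * 2)) (exprM (B h w)).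
have := sqr_ge0 (B h w ^+ 2 - h); nra.
Unshelve. all: by end_near. Qed.

End TaylorNegligible.

(** * Uniqueness of the coefficients of an Ito form *)

Section ItoFormUnique.
Context {R : realType} {dsp : measure_display} {Omega : measurableType dsp}.
Variables (P : probability Omega R) (W : R -> {RV P >-> R}) (t : R).
Hypotheses (HW : standard_brownian W) (t0 : 0 <= t).

Local Notation E X := (\int[P]_w (X w)%:E)%E.
Local Notation B := (dB W t).

(** The two families may be localized on different events. After extension by zero their difference
    equals the form unless an exceptional indicator is 1. It will be used with [Z1 = d log J] and
    [Z2 = d log J - form]. *)
Lemma ito_form_unique (D : R -> set Omega) (Z1 Z2 : R -> Omega -> R) (a b : R) :
  ito_negligible P D Z1 -> ito_negligible P D Z2 ->
  (forall h w, Z1 h w - Z2 h w = ito_form W t a b h w) ->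
  a = 0 /\ b = 0.
Proof.
move=> /ito_negligibleP[G1 [mG1 bad1 o1 s1]] /ito_negligibleP[G2 [mG2 bad2 o2 s2]] Z12.
pose f1 h := ind (G1 h) (Z1 h); pose f2 h := ind (G2 h) (Z2 h).
have near_h1 : \forall h \near (0 : R)^'+, 0 < h <= 1.
  near=> h; apply/andP; split; near: h; [exact: nbhs_right_gt|].
  exact: nbhs_right_le.
have mf1 : \forall h \near (0 : R)^'+, measurable_fun setT (f1 h).
  by apply: filterS mG1 => h [mG _ mZ]; exact: measurable_ind.
have mf2 : \forall h \near (0 : R)^'+, measurable_fun setT (f2 h).
  by apply: filterS mG2 => h [mG _ mZ]; exact: measurable_ind.
have good h w : (f1 h w - f2 h w = ito_form W t a b h w) \/
    1 <= bad G1 h w + bad G2 h w.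
  rewrite /f1 /f2 /ind /bad !indicE !in_setC.
  by case: (w \in G1 h); case: (w \in G2 h) => /=; [left; exact: Z12|right; lra..].
have bad_ge0 (G : R -> set Omega) h w : 0 <= bad G h w by rewrite /bad indicE.
have ssum := smallD (smallD s1 s2) (smallD bad1 bad2).
have a0 : a = 0.
  have sB : small P (fun h w => a ^+ 2 * B h w ^+ 2).
    (* Majorant of [a^2 B^2] on the whole space, so that its exact mean [a^2 h] can be used. Off the
       exceptional events it comes from [a B = f1 - f2 - b h]; on them from [B^2 <= dom + 1], the
       constant being absorbed by the indicators. *)
    pose g h w := 4 * (f1 h w ^+ 2 + f2 h w ^+ 2 + (bad G1 h w + bad G2 h w)) +
      ((a ^+ 2 + 2 * b ^+ 2) * dom h (B h w) +
      a ^+ 2 * (bad G1 h w + bad G2 h w)).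
    have sg : small P g.
      apply: smallD; first by apply: smallZ => //; exact: ssum.
      apply: smallD; last by apply: smallZ; [exact: sqr_ge0|exact: smallD].
      apply: smallZ; last exact: small_dom HW t0.
      by apply: addr_ge0; [|apply: mulr_ge0 => //]; exact: sqr_ge0.
    apply: small_le sg _; apply: filterS near_h1 => h h1; split.
    - apply: measurable_funM => //; apply: measurable_funX; exact: measurable_dB.
    - by move=> w; rewrite mulr_ge0 ?sqr_ge0.
    move=> w; rewrite /g; have h0 : 0 < h by case/andP: h1.
    have d0 := dom_ge0 (B h w) h0; have dh := sqr_h_le_dom (B h w) h1.
    have [u1 u2] := (bad_ge0 G1 h w, bad_ge0 G2 h w).
    have [v1 v2] := (sqr_ge0 (f1 h w), sqr_ge0 (f2 h w)).
    have [va vb] := (sqr_ge0 a, sqr_ge0 b).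
    have adom : 0 <= a ^+ 2 * dom h (B h w) by exact: mulr_ge0.
    have bdom : b ^+ 2 * h ^+ 2 <= b ^+ 2 * dom h (B h w) by exact: ler_wpM2l.
    have [E1|bd] := good h w.
      rewrite /ito_form in E1.
      have i1 : a ^+ 2 * B h w ^+ 2 <= 2 * (f1 h w - f2 h w) ^+ 2 + 2 * (b ^+ 2 * h ^+ 2).
        rewrite E1; have := sqr_ge0 (a * B h w + 2 * b * h); nra.
      have i2 : (f1 h w - f2 h w) ^+ 2 <= 2 * (f1 h w ^+ 2 + f2 h w ^+ 2).
        have := sqr_ge0 (f1 h w + f2 h w); nra.
      have : 0 <= a ^+ 2 * (bad G1 h w + bad G2 h w) by rewrite mulr_ge0// addr_ge0.
      lra.
    have i1 : B h w ^+ 2 <= dom h (B h w) + 1.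
      have := pow4_le_dom (B h w) h1.
      rewrite -[B h w ^+ 4]/(B h w ^+ (2 * 2)) (exprM (B h w)).
      have := sqr_ge0 (B h w ^+ 2 - 1); have := sqr_ge0 (B h w); nra.
    have i2 := ler_wpM2l va i1; have i3 := ler_wpM2l va bd.
    have : 0 <= b ^+ 2 * dom h (B h w) by exact: mulr_ge0.
    move: i2 i3; rewrite !mulrDr mulr1 => i2 i3; lra.
  have : a ^+ 2 = 0; last by move/eqP; rewrite sqrf_eq0 => /eqP.
  apply: o_dt_linear; apply: o_dt_le (sB.2); apply: filterS near_h1 => h /andP[h0 _].
  have -> : E (fun w => a ^+ 2 * B h w ^+ 2) = (a ^+ 2 * h)%:E.
    transitivity (\int[P]_w ((a ^+ 2)%:E * (B h w ^+ 2)%:E))%E; first by [].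
    rewrite integralZl//; last exact: integrable_dB_sqr.
    by rewrite (dB_moment_even HW t0 1 h0) big_ord1 mulr1 expr1.
  by rewrite gee0_abs// lee_fin mulr_ge0 ?sqr_ge0 ?ltW.
split => //.
(* Since [a = 0], [r] vanishes off the exceptional events; on them [|f| <= 1 + f^2], and the
   indicators again absorb the constants. *)
pose r h w := f1 h w - f2 h w - b * h.
pose g h w := f1 h w ^+ 2 + f2 h w ^+ 2 + (bad G1 h w + bad G2 h w) +
   (2 + `|b|) * (bad G1 h w + bad G2 h w).
have sg : small P g.
  by apply: smallD; [exact: ssum|apply: smallZ; [rewrite addr_ge0|exact: smallD]].
have mr : \forall h \near (0 : R)^'+, measurable_fun setT (r h).
  by near=> h; apply: measurable_funB => //; apply: measurable_funB => //; near: h.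
have rg h w : 0 < h <= 1 -> `|r h w| <= g h w.
  move=> /andP[h0 h1]; rewrite /r /g.
  have [u1 u2] := (bad_ge0 G1 h w, bad_ge0 G2 h w).
  have [v1 v2] := (sqr_ge0 (f1 h w), sqr_ge0 (f2 h w)).
  have bb : 0 <= `|b| * (bad G1 h w + bad G2 h w) by rewrite mulr_ge0 ?addr_ge0.
  have [->|bd] := good h w.
    rewrite /ito_form a0 mul0r add0r subrr normr0; lra.
  have i1 := ler_wpM2l (normr_ge0 b) bd.
  have i2 : `|b * h| <= `|b| by rewrite normrM (gtr0_norm h0) ler_piMr.
  have n1 : `|f1 h w| <= 1 + f1 h w ^+ 2.
    by rewrite ler_norml; apply/andP; split; nra.
  have n2 : `|f2 h w| <= 1 + f2 h w ^+ 2.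
    by rewrite ler_norml; apply/andP; split; nra.
  rewrite (le_trans (ler_normB _ _))//.
  rewrite (le_trans (lerD (ler_normB _ _) i2))//.
  move: i1; rewrite mulr1 => i1; lra.
have or : o_dt (fun h => E (r h)).
  apply: (small_dominated sg); near=> h.
  split; first by near: h.
  by move=> w; apply: rg; near: h.
have dint (f : R -> Omega -> R) : (\forall h \near (0 : R)^'+, measurable_fun setT (f h)) ->
    small P (fun h w => f h w ^+ 2) ->
    \forall h \near (0 : R)^'+, P.-integrable setT (EFin \o f h).
  move=> mf sf; near=> h.
  have i1 : P.-integrable setT (EFin \o (fun w => f h w ^+ 2)).
    by near: h; exact: small_integrable.
  have i2 : P.-integrable setT (EFin \o (fun w => 1 + f h w ^+ 2)).
    have -> : EFin \o (fun w => 1 + f h w ^+ 2) =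
        (cst 1%:E \+ (EFin \o (fun w => f h w ^+ 2)%R))%E by [].
    by apply: integrableD => //; exact: finite_measure_integrable_cst.
  apply: (le_integrable measurableT _ _ i2).
    by apply/measurable_EFinP; near: h.
  move=> w _; rewrite !lee_fin [leRHS]ger0_norm; last by rewrite addr_ge0 ?sqr_ge0.
  by rewrite ler_norml; apply/andP; split; nra.
apply: o_dt_linear.
(* [b h = E f1 - E f2 - E r], and all three means are o(h). *)
apply: o_dt_eq (o_dtD (o_dtD o1 (o_dtZ (-1) o2)) (o_dtZ (-1) or)); near=> h.
have i1 : P.-integrable setT (EFin \o f1 h) by near: h; exact: dint.
have i2 : P.-integrable setT (EFin \o f2 h) by near: h; exact: dint.
have -> : E (r h) = (E (f1 h) - E (f2 h) - (b * h)%:E)%E.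
  rewrite -(expectation_cst P (b * h)) -integralB// -integralB//.
  - exact: integrableB.
  - exact: finite_measure_integrable_cst.
move: (integrable_fin_num measurableT i1) (integrable_fin_num measurableT i2).
rewrite -/(f1 h) -/(f2 h).
case: (E (f1 h)) => // x1 _; case: (E (f2 h)) => // x2 _.
transitivity (x1 + -1 * x2 + -1 * (x1 - x2 - b * h))%:E => //.
by congr EFin; ring.
Unshelve. all: by end_near. Qed.

End ItoFormUnique.

(** * Mixed derivatives and the divergence of the drift *)

Section Calculus.
Context {R : realType} {d : nat}.
Implicit Types (f g : 'cV[R]_d -> R) (x : 'cV[R]_d).

Local Notation e j := (delta_mx j ord0 : 'cV[R]_d).

(** Smoothness is phrased through directional derivatives; along a line these are ordinary
    derivatives, open to the one-variable mean value theorem. *)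
Lemma is_derive_line f x v (t : R) : derivable f (x + t *: v) v ->
  is_derive t 1 (fun s : R => f (x + s *: v)) ('D_v f (x + t *: v)).
Proof.
move=> fv.
have E : (fun h : R => h^-1 *:
    (((fun s : R => f (x + s *: v)) \o shift t) (h *: 1) - f (x + t *: v))) =
   (fun h : R => h^-1 *: ((f \o shift (x + t *: v)) (h *: v) - f (x + t *: v))).
  apply/funext => h /=; congr (_ *: (f _ - _)).
  by rewrite [h *: 1]mulr1 scalerDl addrCA.
apply: DeriveDef; first by rewrite /derivable E.
by rewrite /derive E.
Qed.

Lemma mvt_line f x v (s : R) : 0 < s -> (forall y, derivable f y v) ->
  exists2 c, 0 <= c <= s & f (x + s *: v) - f x = 'D_v f (x + c *: v) * s.
Proof.
move=> s0 fv; have D (t : R) := is_derive_line (fv (x + t *: v)).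
have [||c] := @MVT_segment R (fun t => f (x + t *: v))
    (fun t => 'D_v f (x + t *: v)) 0 s.
- exact: ltW.
- by apply: derivable_within_continuous => t _; have [] := D t.
by rewrite in_itv/= scale0r addr0 subr0 => cs ->; exists c.
Qed.

Lemma derivable_shift f w v : (forall y, derivable f y v) ->
  forall y, derivable (fun z => f (z + w)) y v /\
    'D_v (fun z => f (z + w)) y = 'D_v f (y + w).
Proof.
move=> fv y.
have E : (fun h : R => h^-1 *: (((fun z => f (z + w)) \o shift y) (h *: v) - f (y + w))) =
   (fun h : R => h^-1 *: ((f \o shift (y + w)) (h *: v) - f (y + w))).
  by apply/funext => h /=; congr (_ *: (f _ - _)); rewrite addrA.
by split; [rewrite /derivable E; exact: fv|rewrite /derive E].
Qed.

(** The mean value theorem twice: along [v] for [f (z + s w) - f z], then along [w] for ['D_v f]. *)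
Lemma second_difference f x v w (s : R) : 0 < s ->
  (forall y, derivable f y v) -> (forall y, derivable ('D_v f) y w) ->
  exists a b : R, [/\ 0 <= a <= s, 0 <= b <= s &
   f (x + s *: v + s *: w) - f (x + s *: v) - f (x + s *: w) + f x =
   'D_w ('D_v f) (x + a *: v + b *: w) * s * s].
Proof.
move=> s0 fv fvw; pose g z := f (z + s *: w) - f z.
have gD y : derivable g y v /\ 'D_v g y = 'D_v f (y + s *: w) - 'D_v f y.
  have [d1 e1] := derivable_shift (s *: w) fv y.
  by split; [exact: derivableB|rewrite deriveB// e1].
have [a a0s ga] := mvt_line x s0 (fun y => (gD y).1).
have [b b0s gb] := mvt_line (x + a *: v) s0 fvw.
exists a, b; split => //; rewrite -gb -(gD _).2 -ga /g; ring.
Qed.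

(** The limit argument behind equality of mixed derivatives. The intermediate points on the two
    sides may differ, since mean value theorems give no control over them. *)
Lemma continuous_close_eq (P Q : 'cV[R]_d -> R) x v w :
  {for x, continuous P} -> {for x, continuous Q} ->
  (forall s : R, 0 < s -> exists a b a' b' : R,
    [/\ 0 <= a <= s, 0 <= b <= s, 0 <= a' <= s, 0 <= b' <= s &
     P (x + a *: v + b *: w) = Q (x + a' *: v + b' *: w)]) ->
  P x = Q x.
Proof.
move=> c1 c2 PQ; apply/eqP; rewrite -subr_eq0 -normr_eq0.
apply/eqP/le_anti; rewrite normr_ge0 andbT; apply/ler_addgt0Pr => ep ep0.
rewrite add0r; have ep2 : 0 < ep / 2 by rewrite divr_gt0.
move/cvgrPdist_lt : c1 => /(_ _ ep2) /nbhs_normP[r1 /= r10 b1].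
move/cvgrPdist_lt : c2 => /(_ _ ep2) /nbhs_normP[r2 /= r20 b2].
(* With [s = r / (2 M)], every intermediate point lies within [r / 2] of [x]; the summand 1 keeps
   [M] positive. *)
pose M := `|v| + `|w| + 1.
have M0 : 0 < M by rewrite ltr_wpDl// addr_ge0.
pose r := Num.min r1 r2; have r0 : 0 < r by rewrite lt_min r10.
pose s := r / 2 / M; have s0 : 0 < s by rewrite !divr_gt0.
have near a b : 0 <= a <= s -> 0 <= b <= s -> `|x - (x + a *: v + b *: w)| < r.
  move=> /andP[a0 as_] /andP[b0 bs].
  rewrite -addrA opprD addrA subrr sub0r normrN.
  rewrite (le_lt_trans (ler_normD _ _))// !normrZ !ger0_norm//.
  apply: (@le_lt_trans _ _ (s * M)); last by rewrite divfK ?gt_eqF//; lra.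
  by rewrite !mulrDr mulr1 -[leLHS]addr0 !lerD ?ler_wpM2r// ltW.
have [a [b [a' [b' [ha hb ha' hb' E]]]]] := PQ s s0.
have B1 : `|P x - P (x + a *: v + b *: w)| < ep / 2.
  by apply: b1; rewrite /= (lt_le_trans (near _ _ ha hb))// ge_min lexx.
have B2 : `|Q x - Q (x + a' *: v + b' *: w)| < ep / 2.
  by apply: b2; rewrite /= (lt_le_trans (near _ _ ha' hb'))// ge_min lexx orbT.
have -> : P x - Q x = (P x - P (x + a *: v + b *: w)) -
    (Q x - Q (x + a' *: v + b' *: w)).
  by rewrite E opprB addrA subrK.
by rewrite (le_trans (ler_normB _ _))// [leRHS](splitr ep) lerD// ltW.
Qed.

(* Both mixed derivatives are limits of the same second difference. *)
Lemma derive_comm f x v w :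
  (forall y, derivable f y v) -> (forall y, derivable f y w) ->
  (forall y, derivable ('D_v f) y w) -> (forall y, derivable ('D_w f) y v) ->
  {for x, continuous ('D_w ('D_v f))} -> {for x, continuous ('D_v ('D_w f))} ->
  'D_w ('D_v f) x = 'D_v ('D_w f) x.
Proof.
move=> fv fw fvw fwv c1 c2; apply: (@continuous_close_eq _ _ x v w c1 c2) => s s0.
have [a [b [ha hb E1]]] := second_difference x s0 fv fvw.
have [b' [a' [hb' ha' E2]]] := second_difference x s0 fw fwv.
exists a, b, a', b'; split; [exact: ha|exact: hb|exact: ha'|exact: hb'|].
rewrite [x + a' *: v + _]addrAC.
(* The second difference is symmetric in the two directions; cancelling [s] twice leaves the mixed
   derivatives. *)
apply: (@mulIf _ s); first by rewrite gt_eqF.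
apply: (@mulIf _ s); first by rewrite gt_eqF.
apply: etrans (esym E1) (etrans _ E2).
by rewrite (addrAC x (s *: w)); congr (_ + _); exact: addrAC.
Qed.

(* For s = div(a ⊗ a)/2 with div a = 0 one gets s = (grad a) a / 2, and in div s
   the second-order terms add up to the directional derivative of div a. *)
Lemma div_free_drift (u alpha s v : 'cV[R]_d -> 'cV[R]_d) :
  vCk 1 u -> vCk 2 alpha ->
  (forall x, s x = 2^-1 *: tdiv (fun y => outer (alpha y) (alpha y)) x) ->
  (forall x, v x = u x - s x) ->
  (forall x, div alpha x = 0) ->
  (forall x, div u x = 2^-1 * \tr (grad alpha x *m grad alpha x)) ->
  forall x, div v x = 0.
Proof.
move=> Cu Ca sE vE da du x.
pose al i y : R := alpha y i ord0.
have ald i j y : derivable (al i) y (e j) by have [_ /(_ j)[]] := Ca i.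
have aldd i j k y : derivable (partial (al i) j) y (e k).
  by have [_ /(_ j)[_ [_ /(_ k)[]]]] := Ca i.
have aldc i j k : continuous (partial (partial (al i) j) k).
  by have [_ /(_ j)[_ [_ /(_ k)[_]]]] := Ca i.
have ud i j y : derivable (fun z => u z i ord0) y (e j) by have [_ /(_ j)[]] := Cu i.
have sE' i y : s y i ord0 = 2^-1 * \sum_j (partial (al i) j y * al j y).
  rewrite sE !mxE; congr (_ * _).
  transitivity (\sum_j (partial (al i) j y * al j y + al i y * partial (al j) j y)).
    apply: eq_bigr => j _; rewrite /partial.
    have -> : (fun z => outer (alpha z) (alpha z) i j) = al i * al j.
      by apply/funext => z; rewrite /outer mxE big_ord1 mxE.
    rewrite (deriveM (ald i j y) (ald j j y)) addrC.
    by congr (_ + _); exact: mulrC.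
  rewrite big_split/= -mulr_sumr.
  by have := da y; rewrite /div => ->; rewrite mulr0 addr0.
have sD i : is_derive x (e i) (fun y => s y i ord0)
   (2^-1 * \sum_j (partial (partial (al i) j) i x * al j x +
            partial (al i) j x * partial (al j) i x)).
  have -> : (fun y => s y i ord0) =
      2^-1 *: \sum_(j < d) (partial (al i) j * al j : 'cV[R]_d -> R).
    by apply/funext => y; rewrite sE' /= fct_sumE.
  apply: is_deriveZ; apply: is_derive_sum => j.
  have D1 : is_derive x (e i) (partial (al i) j) (partial (partial (al i) j) i x).
    by apply: DeriveDef => //; exact: aldd.
  have D2 : is_derive x (e i) (al j) (partial (al j) i x).
    by apply: DeriveDef => //; exact: ald.
  apply: (is_derive_eq (is_deriveM D1 D2)).
  by rewrite addrC; congr (_ + _); exact: mulrC.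
have vD i : partial (fun y => v y i ord0) i x =
  partial (fun y => u y i ord0) i x - partial (fun y => s y i ord0) i x.
  have -> : (fun y => v y i ord0) = (fun y => u y i ord0) - (fun y => s y i ord0).
    by apply/funext => y; rewrite vE !mxE.
  by rewrite /partial deriveB//; have [] := sD i.
rewrite /div; under eq_bigr do rewrite vD.
rewrite sumrB; have := du x; rewrite /div => ->.
under eq_bigr => i _ do rewrite [partial _ _ _](@derive_val _ _ _ _ _ _ _ (sD i)).
rewrite -mulr_sumr -mulrBr; apply/eqP; rewrite mulf_eq0; apply/orP; right.
under [X in _ - X]eq_bigr do rewrite big_split/=.
rewrite big_split/= exchange_big/=.
have -> : \sum_j \sum_i partial (partial (al i) j) i x * al j x = 0.
  apply: big1 => j _; rewrite -mulr_suml.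
  under eq_bigr => i _.
    rewrite [partial _ _ _](_ : _ = 'D_(e j) (partial (al i) i) x); last first.
      by apply: derive_comm => // y; [exact: aldd|exact: aldd|exact: aldc|exact: aldc].
    over.
  have -> : \sum_i 'D_(e j) (partial (al i) i) x = 0; last by rewrite mul0r.
  (* The divergence vanishes at every point, so it is the zero function and can be differentiated
     along [e j]. *)
  rewrite -(derive_sum (h := fun i => partial (al i) i))//.
  rewrite (_ : \sum_i _ = cst 0) ?derive_cst//.
  by apply/funext => y; rewrite fct_sumE; exact: da.
(* What remains of div s is half the sum of the products of the j-th partial of [alpha_i] and the
   i-th partial of [alpha_j], that is [tr (A^2) / 2], which balances div u. *)
rewrite add0r subr_eq0; apply/eqP; apply: eq_bigr => i _.
by rewrite mxE; apply: eq_bigr => j _; rewrite !mxE.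
Qed.

End Calculus.

(** * Volume ratio and Hencky strains of the one-step map *)

Section Deformation.
Context {R : realType}.

Lemma measurable_det (dsp : measure_display) (T : measurableType dsp) (D : set T) n
    (M : T -> 'M[R]_n) : (forall i j, measurable_fun D (fun b => M b i j)) ->
  measurable_fun D (fun b => \det (M b)).
Proof.
move=> mM; rewrite /determinant; apply: measurable_sum => s.
by apply: measurable_funM => //; apply: measurable_prod => i _.
Qed.

Lemma measurable_mxtrace (dsp : measure_display) (T : measurableType dsp) (D : set T) n
    (M : T -> 'M[R]_n) : (forall i j, measurable_fun D (fun b => M b i j)) ->
  measurable_fun D (fun b => \tr (M b)).
Proof. by move=> mM; apply: measurable_sum => i. Qed.

Lemma measurable_mulmx (dsp : measure_display) (T : measurableType dsp) (D : set T)
    m n p (M : T -> 'M[R]_(m, n)) (N : T -> 'M[R]_(n, p)) i j :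
  (forall i j, measurable_fun D (fun b => M b i j)) ->
  (forall i j, measurable_fun D (fun b => N b i j)) ->
  measurable_fun D (fun b => (M b *m N b) i j).
Proof.
move=> mM mN; under eq_fun do rewrite mxE.
by apply: measurable_sum => k; exact: measurable_funM.
Qed.

Lemma measurable_mx_expr (dsp : measure_display) (T : measurableType dsp) (D : set T) n
    (M : T -> 'M[R]_n) k i j : (forall i j, measurable_fun D (fun b => M b i j)) ->
  measurable_fun D (fun b => (M b ^+ k) i j).
Proof.
move=> mM; elim: k i j => [|k IH] i j.
  by under eq_fun do rewrite expr0; exact: measurable_cst.
by under eq_fun do rewrite exprS; exact: measurable_mulmx.
Qed.

Variables (n : nat) (A L : 'M[R]_n).

(** Deterministic counterpart of [deformation], which is its value at [b = dW]. *)
Definition perturb (b h : R) : 'M[R]_n := 1%:M + b *: A + h *: L.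

Let X (b h : R) : 'M[R]_n := b *: A + h *: L.
Let C : R := `|A| + `|L|.

Let ler_mx_norm (M : 'M[R]_n) i j : `|M i j| <= `|M|.
Proof.
rewrite [leRHS]/Num.Def.normr/= mx_normrE.
exact: (le_bigmax _ (fun ij : 'I_n * 'I_n => `|M ij.1 ij.2|) (i, j)).
Qed.

Let C0 : 0 <= C. Proof. by rewrite addr_ge0. Qed.

Let X_bound b h i j : 0 < h -> `|X b h i j| <= C * (`|b| + h).
Proof.
move=> h0; rewrite !mxE (le_trans (ler_normD _ _))// !normrM (gtr0_norm h0).
have := ler_wpM2l (normr_ge0 b) (ler_mx_norm A i j).
have := ler_wpM2l (ltW h0) (ler_mx_norm L i j).
have := mulr_ge0 (normr_ge0 b) (normr_ge0 L).
have := mulr_ge0 (ltW h0) (normr_ge0 A).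
rewrite /C; nra.
Qed.

Let radius_bound (dl : R) : 0 < dl -> exists2 e : R, 0 < e <= 1 &
  forall h b : R, 0 < h <= e -> `|b| <= e ->
   0 <= C * (`|b| + h) <= dl.
Proof.
move=> dl0; have c1 : 0 < 2 * (C + 1) by rewrite mulr_gt0// ltr_wpDl.
(* [C + 1] keeps the divisor positive when both gradients vanish. *)
exists (Num.min 1 (dl / (2 * (C + 1)))).
  by rewrite lt_min ge_min lexx ltr01 divr_gt0.
move=> h b /andP[h0]; rewrite !le_min => /andP[_ hd] /andP[_ bd].
apply/andP; split; first by rewrite mulr_ge0// addr_ge0// ltW.
move: hd bd; rewrite !ler_pdivlMr// => hd bd.
have := mulr_ge0 C0 (normr_ge0 b); have := mulr_ge0 C0 (ltW h0).
have := normr_ge0 b; lra.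
Qed.

(** For [h <= 1], [(|b| + h)^2 <= 2 (b^2 + h)]: a remainder cubic in the entries takes the form that
    [dom] controls. *)
Let cube_bound (b h : R) : 0 < h <= 1 ->
  (C * (`|b| + h)) ^+ 3 <= 2 * C ^+ 3 * ((`|b| + h) * (b ^+ 2 + h)).
Proof.
move=> /andP[h0 h1]; rewrite exprMn -(real_normK (num_real b)).
have y0 := normr_ge0 b; move: `|b| y0 => y y0.
rewrite [leRHS](_ : _ = C ^+ 3 * ((y + h) * (2 * (y ^+ 2 + h)))); last by ring.
apply: ler_wpM2l; first by rewrite exprn_ge0.
rewrite exprS.
apply: ler_wpM2l; first by rewrite addr_ge0// ltW.
have := sqr_ge0 (y - h); have : h ^+ 2 <= h by rewrite expr2 ler_piMr// ltW.
nra.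
Qed.

Let perturbE b h : perturb b h = 1%:M + X b h.
Proof. by rewrite /perturb /X addrA. Qed.

(** Of the second-order terms, [b h tr (A L)] and [h^2 tr (L^2) / 2] already have the size of the
    remainder; only [b^2 tr (A^2) / 2] survives, split between drift and compensator. *)
Lemma ln_det_perturb : exists K, exists2 dl, (0 <= K) && (0 < dl <= 1) &
  forall h b : R, 0 < h <= dl -> `|b| <= dl -> 0 < \det (perturb b h) /\
  `|ln (\det (perturb b h)) - (\tr A * b + (\tr L - 2^-1 * \tr (A *m A)) * h) +
     2^-1 * \tr (A *m A) * (b ^+ 2 - h)| <= K * ((`|b| + h) * (b ^+ 2 + h)).
Proof.
have [K1 K10 [dl1 dl10 T]] := @ln_det_1D_taylor2 R n.
have [dl dlP radius] := radius_bound dl10.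
exists (K1 * (2 * C ^+ 3) + (`|\tr (A *m L)| + `|\tr (L *m L)|)), dl.
  by rewrite dlP andbT addr_ge0 ?addr_ge0// mulr_ge0// mulr_ge0// exprn_ge0.
move=> h b hd bd; have h1 : 0 < h <= 1.
  by case/andP: dlP => _; case/andP: hd => -> /le_trans; exact.
have h0 : 0 < h by case/andP: h1.
have /andP[r0 rd] := radius _ _ hd bd.
have [] := T (X b h) _ rd (fun i j => X_bound b i j h0) r0.
rewrite -perturbE => dpos lT; split=> //.
set T1 := ln _ - _ + _ in lT.
have trX : \tr (X b h) = b * \tr A + h * \tr L by rewrite raddfD/= !mxtraceZ.
have trXX : \tr (X b h *m X b h) = b ^+ 2 * \tr (A *m A) +
    2 * b * h * \tr (A *m L) + h ^+ 2 * \tr (L *m L).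
  rewrite /X !mulmxDl !mulmxDr -!scalemxAl -!scalemxAr !scalerA !raddfD/= !mxtraceZ.
  by rewrite (mxtrace_mulC L A); ring.
rewrite [leLHS](_ : _ = `|T1 - (b * h * \tr (A *m L) +
    2^-1 * h ^+ 2 * \tr (L *m L))|); last first.
  by congr (`| _ |); rewrite /T1 trX trXX; field.
rewrite (le_trans (ler_normB _ _))// mulrDl lerD//.
  by rewrite (le_trans lT)// -mulrA ler_wpM2l// cube_bound.
have e1 : `|b| * h <= (`|b| + h) * (b ^+ 2 + h).
  by rewrite ler_pM ?(ltW h0)// ?lerDl ?lerDr ?sqr_ge0 ?(ltW h0).
have e2 : 2^-1 * h ^+ 2 <= (`|b| + h) * (b ^+ 2 + h).
  have : h * h <= (`|b| + h) * (b ^+ 2 + h).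
    by rewrite ler_pM ?(ltW h0)// lerDr ?sqr_ge0.
  by have := sqr_ge0 h; rewrite expr2; lra.
rewrite (le_trans (ler_normD _ _))// mulrDl lerD//.
  by rewrite !normrM (gtr0_norm h0) mulrC ler_wpM2l.
rewrite normrM mulrC ler_wpM2l// ger0_norm// mulr_ge0// sqr_ge0//.
Qed.

Lemma measurable_perturb h i j : measurable_fun setT (fun b : R => perturb b h i j).
Proof.
rewrite /perturb; under eq_fun do rewrite !mxE.
by apply: measurable_funD => //; apply: measurable_funD => //; exact: measurable_funM.
Qed.

(** Write [F^T F = 1 + Y]. The expansions of log det and of the trace of [mxlog] are taken at the
    same [Y], where their first two orders coincide and cancel, and [log det (1 + Y) = 2 log det F].
    No expansion of [Y] in terms of [b] and [h] is made. *)
Lemma ln_det_hencky : exists K, exists2 dl, (0 <= K) && (0 < dl <= 1) &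
  (forall h : R, 0 < h <= dl -> measurable_fun [set b : R | `|b| <= dl]
     (fun b => \tr (2^-1 *: mxlog ((perturb b h)^T *m perturb b h)))) /\
  forall h b : R, 0 < h <= dl -> `|b| <= dl -> 0 < \det (perturb b h) /\
  `|ln (\det (perturb b h)) - \tr (2^-1 *: mxlog ((perturb b h)^T *m perturb b h))|
    <= K * ((`|b| + h) * (b ^+ 2 + h)).
Proof.
have [K1 K10 [dl1 dl10 T1]] := @ln_det_1D_taylor2 R n.
have [K2 K20 [dl2 dl20 T2]] := @tr_mxlog_1D_taylor2 R n.
(* For [r <= 1] an entry of [Y] is at most [r + r + n r^2 <= (n + 2) r]. The radius below asks for
   [dl1] to make [\det F] positive, 1 for this bound, and the quotients by [N] for the two
   expansions at [Y]. *)
pose N : R := n%:R + 2; have N0 : 0 < N by rewrite ltr_wpDl.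
pose dl3 := Num.min (Num.min dl1 1) (Num.min (dl1 / N) (dl2 / N)).
have dl30 : 0 < dl3 by rewrite !lt_min dl10 ltr01 !divr_gt0.
have [dl dlP radius] := radius_bound dl30.
pose Y b h := X b h + (X b h)^T + (X b h)^T *m X b h.
have YE b h : (perturb b h)^T *m perturb b h = 1%:M + Y b h.
  have -> : (perturb b h)^T = 1%:M + (X b h)^T.
    by rewrite perturbE; apply/matrixP => i j; rewrite !mxE eq_sym.
  rewrite perturbE /Y; move: (X b h) => Z.
  by rewrite mulmxDl !mulmxDr !mul1mx mulmx1 !addrA.
have Yb (h b : R) : 0 < h <= dl -> `|b| <= dl -> let r := C * (`|b| + h) in
    [/\ 0 <= r, r <= dl1, N * r <= dl1, N * r <= dl2 &
      forall i j, `|Y b h i j| <= N * r].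
  move=> hd bd r; have /andP[r0] := radius _ _ hd bd.
  rewrite -/r !le_min => /andP[/andP[r1 r2]].
  rewrite !ler_pdivlMr// ![r * N]mulrC => /andP[r3 r4]; split => // i j.
  have h0 : 0 < h by case/andP: hd.
  have Xr := fun i j => X_bound b i j h0.
  have -> : Y b h i j = X b h i j + X b h j i + ((X b h)^T *m X b h) i j.
    by rewrite /Y mxE [in LHS]mxE [(_^T) i j]mxE.
  rewrite (le_trans (ler_normD _ _))// /N mulrDl addrC lerD//.
    rewrite (@le_trans _ _ (n%:R * (r * r)))//.
      by apply: ler_norm_mulmx => k l; [rewrite [(X b h)^T k l]mxE|]; exact: Xr.
    by rewrite ler_wpM2l// ler_piMr.
  by rewrite (le_trans (ler_normD _ _))// mulrDl mul1r lerD.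
exists (2^-1 * (K1 + K2) * N ^+ 3 * (2 * C ^+ 3)), dl.
  by rewrite dlP andbT !mulr_ge0 ?addr_ge0 ?exprn_ge0// ltW.
split=> [h hd|h b hd bd].
  have mY i j : measurable_fun [set b : R | `|b| <= dl]
      (fun b => (((perturb b h)^T *m perturb b h) - 1%:M) i j).
    have -> : (fun b => (((perturb b h)^T *m perturb b h) - 1%:M) i j) =
        (fun b => ((perturb b h)^T *m perturb b h) i j - (1%:M : 'M[R]_n) i j).
      by apply/funext => b; rewrite !mxE.
    apply: measurable_funB => //; apply: measurable_mulmx => k l.
      rewrite [X in measurable_fun _ X](_ : _ = (fun b => perturb b h l k)).
        exact: measurable_funTS (measurable_perturb h l k).
      by apply/funext => b; rewrite mxE.
    exact: measurable_funTS (measurable_perturb h k l).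
  rewrite [X in measurable_fun _ X](_ : _ = (fun b =>
      2^-1 * \tr (mxlog ((perturb b h)^T *m perturb b h)))); last first.
    by apply/funext => b; exact: mxtraceZ.
  apply: measurable_funM => //.
  (* On the ball the series converges, and its trace is a pointwise limit of polynomials in [b]. *)
  apply: (measurable_fun_cvg (h := fun m b => \sum_(0 <= k < m) ((-1) ^+ k / k.+1%:R *
     \tr ((((perturb b h)^T *m perturb b h) - 1%:M) ^+ k.+1)))).
    move=> m; apply: measurable_sum => k; apply: measurable_funM => //.
    by apply: measurable_mxtrace => i j; exact: measurable_mx_expr.
  move=> b bd; have [r0 _ _ r4 Yr] := Yb h b hd bd.
  have [H _] := T2 (Y b h) _ r4 Yr (mulr_ge0 (ltW N0) r0).
  by rewrite YE [1%:M + _ - _]addrAC subrr add0r.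
have [r0 r1 r3 r4 Yr] := Yb h b hd bd; have Nr0 := mulr_ge0 (ltW N0) r0.
have h1 : 0 < h <= 1.
  by case/andP: dlP => _; case/andP: hd => -> /le_trans; exact.
have h0 : 0 < h by case/andP: h1.
have [dpos _] := T1 (X b h) _ r1 (fun i j => X_bound b i j h0) r0.
have [_ lT1] := T1 (Y b h) _ r3 Yr Nr0.
have [_ lT2] := T2 (Y b h) _ r4 Yr Nr0.
rewrite -perturbE in dpos; split => //.
have lnE : ln (\det (1%:M + Y b h)) = 2 * ln (\det (perturb b h)).
  by rewrite -YE det_mulmx det_tr lnM ?posrE//; ring.
rewrite mxtraceZ YE; rewrite lnE in lT1.
rewrite [leLHS](_ : _ = `|2^-1 *
   ((2 * ln (\det (perturb b h)) - \tr (Y b h) + 2^-1 * \tr (Y b h *m Y b h)) -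
   (\tr (mxlog (1%:M + Y b h)) - \tr (Y b h) + 2^-1 * \tr (Y b h *m Y b h)))|); last first.
  by congr (`| _ |); field.
rewrite normrM ger0_norm// [leRHS](_ : _ = 2^-1 * ((K1 + K2) *
  (N ^+ 3 * (2 * C ^+ 3 * ((`|b| + h) * (b ^+ 2 + h)))))); last by ring.
apply: ler_wpM2l => //.
rewrite (le_trans (ler_normB _ _))// (le_trans (lerD lT1 lT2))//.
rewrite -mulrDl; apply: ler_wpM2l; first exact: addr_ge0.
rewrite exprMn; apply: ler_wpM2l; first by rewrite exprn_ge0// ltW.
exact: cube_bound.
Qed.

End Deformation.

(** * The logarithmic volume as an Ito increment *)

Lemma div_mxtrace (R : realType) (d : nat) (f : 'cV[R]_d -> 'cV[R]_d) x :
  div f x = \tr (grad f x).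
Proof. by apply: eq_bigr => i _; rewrite mxE. Qed.

Section LogVolume.
Context {R : realType} {dsp : measure_display} {Omega : measurableType dsp}.
Variables (P : probability Omega R) (W : R -> {RV P >-> R}) (d : nat).
Variables (u alpha : 'cV[R]_d -> R -> 'cV[R]_d) (x : 'cV[R]_d) (t : R).
Hypotheses (HW : standard_brownian W) (t0 : 0 <= t).

Local Notation A := (grad (alpha ^~ t) x).
Local Notation L := (grad (u ^~ t) x).
Local Notation D := (orientation_preserved u alpha W x t).

Let measurable_ln_det h (S : set R) :
  measurable_fun S (fun b => ln (\det (perturb A L b h))).
Proof.
apply: measurable_funTS; apply: measurableT_comp; first exact: measurable_ln.
by apply: measurable_det => i j; exact: measurable_perturb.
Qed.

Lemma dlogJ_hencky_material :
  ito_eq P D (dlogJ u alpha W x t) (fun h w => \tr (hencky_material u alpha W x t h w)).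
Proof.
have [K [dl /andP[K0 dlP] [mz T]]] := ln_det_hencky A L.
apply: (@ito_negligible_taylor _ _ _ _ _ _ HW t0 _ _ (fun h b =>
  ln (\det (perturb A L b h)) -
  \tr (2^-1 *: mxlog ((perturb A L b h)^T *m perturb A L b h))) 0 K dl) => //.
- by move=> h hd; apply: measurable_funB; [exact: measurable_ln_det|exact: mz].
- by move=> h b hd bd; rewrite mul0r addr0; have [] := T h b hd bd.
- by move=> h w hd bd; have [] := T h _ hd bd.
Qed.

(** [F F^T] is the material product for [F^T], so the material estimate for the transposed gradients
    applies; the determinant is unchanged. *)
Lemma dlogJ_hencky_spatial :
  ito_eq P D (dlogJ u alpha W x t) (fun h w => \tr (hencky_spatial u alpha W x t h w)).
Proof.
have [K [dl /andP[K0 dlP] [mz T]]] := ln_det_hencky A^T L^T.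
have perturbT b h : perturb A^T L^T b h = (perturb A L b h)^T.
  by apply/matrixP => i j; rewrite !mxE eq_sym.
apply: (@ito_negligible_taylor _ _ _ _ _ _ HW t0 _ _ (fun h b =>
  ln (\det (perturb A L b h)) -
  \tr (2^-1 *: mxlog (perturb A L b h *m (perturb A L b h)^T))) 0 K dl) => //.
- move=> h hd; apply: measurable_funB; first exact: measurable_ln_det.
  have := mz h hd; congr measurable_fun; apply/funext => b.
  by rewrite perturbT trmxK.
- move=> h b hd bd; rewrite mul0r addr0; have [_] := T h b hd bd.
  by rewrite perturbT trmxK det_tr.
- by move=> h w hd bd; have [] := T h _ hd bd; rewrite perturbT det_tr.
Qed.

Lemma dlogJ_ito_form :
  ito_eq P D (dlogJ u alpha W x t)
    (ito_form W t (div (alpha ^~ t) x) (div (u ^~ t) x - 2^-1 * \tr (A *m A))).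
Proof.
have [K [dl /andP[K0 dlP] T]] := ln_det_perturb A L.
rewrite !div_mxtrace.
apply: (@ito_negligible_taylor _ _ _ _ _ _ HW t0 _ _ (fun h b =>
  ln (\det (perturb A L b h)) -
  (\tr A * b + (\tr L - 2^-1 * \tr (A *m A)) * h)) (2^-1 * \tr (A *m A)) K dl) => //.
- move=> h hd; apply: measurable_funB; first exact: measurable_ln_det.
  by apply: measurable_funD => //; exact: measurable_funM.
- by move=> h b hd bd; have [] := T h b hd bd.
- by move=> h w hd bd; have [] := T h _ hd bd.
Qed.

End LogVolume.

Theorem corollary2p2 (R : realType) (dsp : measure_display)
    (Omega : measurableType dsp) (P : probability Omega R)
    (W : R -> {RV P >-> R}) (d : nat)
    (u alpha : 'cV[R]_d -> R -> 'cV[R]_d)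
    (HW : standard_brownian W)
    (Hu : forall t : R, 0 <= t -> vCk 1 (u ^~ t))
    (Halpha : forall t : R, 0 <= t -> vCk 2 (alpha ^~ t)) :
  let A := fun x t => grad (alpha ^~ t) x in
  let isochoric := fun x t =>
    ito_eq P (orientation_preserved u alpha W x t)
           (dlogJ u alpha W x t) (fun _ _ => 0) in
  let conditions := fun x t =>
    div (alpha ^~ t) x = 0 /\
    div (u ^~ t) x = 2^-1 * \tr (A x t *m A x t) in
  [/\ (forall x t, 0 <= t ->
         ito_eq P (orientation_preserved u alpha W x t)
           (dlogJ u alpha W x t)
           (fun h w => \tr (hencky_material u alpha W x t h w)) /\
         ito_eq P (orientation_preserved u alpha W x t)
           (dlogJ u alpha W x t)
           (fun h w => \tr (hencky_spatial u alpha W x t h w))),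
      (forall x t, 0 <= t ->
         ito_eq P (orientation_preserved u alpha W x t)
           (dlogJ u alpha W x t)
           (ito_form W t (div (alpha ^~ t) x)
              (div (u ^~ t) x - 2^-1 * \tr (A x t *m A x t)))),
      (forall x t, 0 <= t -> (isochoric x t <-> conditions x t)) &
      (forall s v : 'cV[R]_d -> R -> 'cV[R]_d,
         (forall x t,
            s x t = 2^-1 *: tdiv (fun y => outer (alpha y t) (alpha y t)) x) ->
         (forall x t, v x t = u x t - s x t) ->
         forall t, 0 <= t -> (forall x, conditions x t) ->
         forall x, div (v ^~ t) x = 0)].
Proof.
move=> A isochoric conditions; split.
- by move=> x t t0; split; [exact: dlogJ_hencky_material|exact: dlogJ_hencky_spatial].
- by move=> x t t0; exact: dlogJ_ito_form.
- move=> x t t0; have form := dlogJ_ito_form u alpha x HW t0; split=> [iso|[da du]].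
    have [|da /eqP] := @ito_form_unique _ _ _ _ _ _ HW t0 _ _ _
        (div (alpha ^~ t) x) (div (u ^~ t) x - 2^-1 * \tr (A x t *m A x t)) iso form.
      by move=> h w; rewrite subr0 opprB addrC subrK.
    by rewrite subr_eq0 => /eqP.
  (* Under the conditions the form is the zero family, and the expansion itself states
     isochoricity. *)
  move: form; rewrite da du subrr; congr ito_negligible.
  by apply/funext => h; apply/funext => w; rewrite /ito_form !mul0r addr0.
- move=> s v sE vE t t0 cond x.
  apply: (@div_free_drift _ _ (u ^~ t) (alpha ^~ t) (s ^~ t) (v ^~ t)).
  + exact: Hu.
  + exact: Halpha.
  + by move=> y; exact: sE.
  + by move=> y; exact: vE.
  + by move=> y; have [] := cond y.
  + by move=> y; have [] := cond y.
Qed.
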